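(* Let $S=\begin{pmatrix}A&B\\C&D\end{pmatrix}\in\mathrm{Sp}(d,\mathbb R)$ with $B\neq 0_d$, and let $\hat S$ be a metaplectic operator with projection $S$. Let $M,N$ be real symmetric positive-semidefinite $d\times d$ matrices with $\ker(M)=\ker(B)$ and $R(N)=R(B)$. Let $f\in L^2(\mathbb R^d)$ satisfy, for some constant $c>0$, $$|f(x)|\le c\,e^{-\pi Mx\cdot x}\ \text{ for a.e. } x\in\mathbb R^d,\qquad |\hat Sf(\xi)|\le c\,e^{-\pi N\xi\cdot\xi}\ \text{ for a.e. } \xi\in\mathbb R^d.$$ If $\lambda>1$ for some eigenvalue $\lambda$ of $MB^TNB$, then $f=0$ almost everywhere.
   Context: $\mathrm{Sp}(d,\mathbb R)$ is the group of real $2d\times 2d$ matrices $S$ with $S^TJS=J$, where $J=\begin{pmatrix}0_d&I_d\\-I_d&0_d\end{pmatrix}$, written in $d\times d$ blocks $S=\begin{pmatrix}A&B\\C&D\end{pmatrix}$. For $f,g\in L^2(\mathbb R^d)$ the cross-Wigner distribution is $W(f,g)(x,\xi)=\int_{\mathbb R^d}f(x+t/2)\overline{g(x-t/2)}e^{-2\pi i\xi\cdot t}\,dt$. A metaplectic operator with projection $S$ is a unitary operator $\hat S$ on $L^2(\mathbb R^d)$ with $W(\hat Sf,\hat Sg)(z)=W(f,g)(S^{-1}z)$ for all $f,g\in L^2(\mathbb R^d)$, $z\in\mathbb R^{2d}$ (unique up to a unimodular constant). $\ker$ and $R$ denote kernel and range; $Mx\cdot x=(Mx)\cdot x$ with the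 standard inner product. *)

(* Defs.v *)
From HB Require Import structures.
From mathcomp Require Import all_boot all_order all_algebra.
From mathcomp Require Import all_classical all_reals all_analysis.
From mathcomp Require Import complex.
Set Implicit Arguments. Unset Strict Implicit. Unset Printing Implicit Defensive.
Import Order.TTheory GRing.Theory Num.Theory.
Local Open Scope ring_scope.

Section Defs.
Variable R : realType.

(* points of R^n are column vectors 'cV[R]_n; the measure-theoretic layer   *)
(* works on n.-tuple R (product Borel sigma-algebra) through colv.           *)
Definition colv (n : nat) (t : n.-tuple R) : 'cV[R]_n := \col_i tnth t i.

(* n-dimensional Lebesgue integral of a nonnegative function, as the        *)
(* iterated one-dimensional Lebesgue integral (Tonelli).                     *)
Fixpoint intn (n : nat) : (n.-tuple R -> \bar R) -> \bar R :=
  match n with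
  | 0 => fun g => g [tuple]
  | n'.+1 => fun g =>
      (\int[@lebesgue_measure R]_x intn (fun t => g (cons_tuple x t)))%E
  end.

Definition intv (n : nat) (g : 'cV[R]_n -> \bar R) : \bar R :=
  intn (fun t => g (colv t)).

Definition ae (n : nat) (P : 'cV[R]_n -> Prop) : Prop :=
  exists B : set (n.-tuple R), measurable B /\
    intn (fun t => (\1_B t)%:E) = 0%E /\ ([set t | ~ P (colv t)] `<=` B)%classic.

Definition rint (n : nat) (u : 'cV[R]_n -> R) : R :=
  fine (intv (fun x => (Num.max (u x) 0)%:E))
  - fine (intv (fun x => (Num.max (- u x) 0)%:E)).

Definition cint (n : nat) (F : 'cV[R]_n -> R[i]) : R[i] :=
  (rint (fun x => complex.Re (F x)) +i* rint (fun x => complex.Im (F x)))%C.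

(* square-integrable (Borel-measurable representatives) *)
Definition L2 (n : nat) (f : 'cV[R]_n -> R[i]) : Prop :=
  [/\ measurable_fun setT (fun t : n.-tuple R => complex.Re (f (colv t))),
      measurable_fun setT (fun t : n.-tuple R => complex.Im (f (colv t))) &
      (intv (fun x => ((Normc.normc (f x)) ^+ 2)%:E) < +oo)%E].

Definition L2norm2 (n : nat) (f : 'cV[R]_n -> R[i]) : \bar R :=
  intv (fun x => ((Normc.normc (f x)) ^+ 2)%:E).

Definition dotv (n : nat) (x y : 'cV[R]_n) : R := \sum_i x i 0 * y i 0.

Definition expi (th : R) : R[i] := (cos th +i* sin th)%C.

Definition wigner (n : nat) (f g : 'cV[R]_n -> R[i]) (x xi : 'cV[R]_n) : R[i] :=
  cint (fun t => f (x + 2^-1 *: t) * conjc (g (x - 2^-1 *: t))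
                 * expi (- (2 * pi * dotv xi t))).

Definition wignerz (n : nat) (f g : 'cV[R]_n -> R[i]) (z : 'cV[R]_(n + n)) :=
  wigner f g (usubmx z) (dsubmx z).

Definition Jmx (n : nat) : 'M[R]_(n + n) :=
  block_mx 0 1%:M (- 1%:M) 0.

Definition symplectic (n : nat) (S : 'M[R]_(n + n)) : Prop :=
  S^T *m Jmx n *m S = Jmx n.

(* metaplectic operator with projection S: a unitary operator on L^2(R^n)   *)
(* (acting on representatives, well defined on a.e.-classes, linear,        *)
(* norm preserving, onto) satisfying W(Sf,Sg)(z) = W(f,g)(S^{-1} z).        *)
Definition metaplectic (n : nat) (S : 'M[R]_(n + n))
    (Sh : ('cV[R]_n -> R[i]) -> ('cV[R]_n -> R[i])) : Prop :=
  (forall f, L2 f -> L2 (Sh f)) /\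
  (forall f g, L2 f -> L2 g -> ae (fun x => f x = g x) ->
     ae (fun x => Sh f x = Sh g x)) /\
  (forall (a b : R[i]) f g, L2 f -> L2 g ->
     ae (fun x => Sh (fun y => a * f y + b * g y) x = a * Sh f x + b * Sh g x)) /\
  (forall f, L2 f -> L2norm2 (Sh f) = L2norm2 f) /\
  (forall g, L2 g -> exists f, L2 f /\ ae (fun x => Sh f x = g x)) /\
  (forall f g, L2 f -> L2 g -> forall z : 'cV[R]_(n + n),
     wignerz (Sh f) (Sh g) z = wignerz f g (invmx S *m z)).

Definition qf (n : nat) (M : 'M[R]_n) (x : 'cV[R]_n) : R := (x^T *m M *m x) 0 0.

Definition sym_psd (n : nat) (M : 'M[R]_n) : Prop :=
  M^T = M /\ forall x, 0 <= qf M x.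

Definition mxker (n : nat) (M : 'M[R]_n) : set 'cV[R]_n := [set x | M *m x = 0].
Definition mxrange (n : nat) (M : 'M[R]_n) : set 'cV[R]_n :=
  [set y | exists x, y = M *m x].

End Defs.

(* Main.v *)
(* By covariance of the Wigner distribution under [Sh], the Fourier transform of
   [|f|^2] at [v] is the matrix coefficient of [Sh f] for the phase space shift
   [(B v, D v)].  Take [v = tau a] with [a = M b], [b] an eigenvector of
   [B^T N B M]; set [alpha = qf M b], so that [qf N (B a) = lambda alpha].  Up to
   normalisation, the decay of [f] says that the positive measure [|f|^2 dx],
   projected along [a], has tails [exp (- y^2 / alpha)], and the decay of [Sh f]
   says that its Fourier transform is [O(exp (- lambda alpha tau^2))].  Since
   [lambda > 1], a one-dimensional Hardy theorem for positive measures gives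
   [f = 0].

   Neither decay controls the directions of [ker B], resp. of [(range B)^perp], so
   [|f|^2] is first multiplied by a Gaussian in the coordinates dual to [ker B].
   This is an average of modulations by elements [p] of [ker B], which [Sh]
   conjugates to modulations by [D p], i.e. to a Gaussian weight transversal to
   [range B].

   For Hardy's theorem, let [L u] be the integral of [exp (- u^2 y^2)] against the
   measure.  The Fourier transform of a Gaussian turns [u * L u] into an integral
   of [exp (- tau^2 / (4 u^2))] against the Fourier transform of the measure.  The
   first is an odd function of [u], analytic on a disc; the second is an even
   function, analytic outside a smaller disc.  Where both converge they agree, so
   both vanish. *)
Require Import Defs.
From HB Require Import structures.
From mathcomp Require Import all_boot all_order all_algebra.
From mathcomp Require Import all_classical all_reals all_analysis.
From mathcomp Require Import measurable_realfun complex.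
From mathcomp Require Import ring lra.
Import Order.TTheory GRing.Theory Num.Theory.
Import numFieldNormedType.Exports.
Set Implicit Arguments.
Unset Strict Implicit.
Unset Printing Implicit Defensive.
Local Open Scope ring_scope.
Local Open Scope classical_set_scope.

(** * Laplace and Fourier transforms *)

Lemma expr_le_fact_expR (R : realType) (k : nat) (x : R) :
  0 <= x -> x ^+ k <= k`!%:R * expR x.
Proof.
move=> x0; rewrite mulrC -ler_pdivrMr ?ltr0n ?fact_gt0//.
case: k => [|k]; first by rewrite expr0 fact0 divr1 -expR0 ler_expR.
by apply: le_trans (expR_ge1Dxn k x0); rewrite lerDr.
Qed.

Lemma measurable_cos (R : realType) : measurable_fun setT (@cos R).
Proof. by apply: continuous_measurable_fun; exact: continuous_cos. Qed.

Lemma measurable_sin (R : realType) : measurable_fun setT (@sin R).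
Proof. by apply: continuous_measurable_fun; exact: continuous_sin. Qed.

Section exponential_moments.
Context {R : realType} {dT : measure_display} {T : measurableType dT}.
Variable m : {measure set T -> \bar R}.

Lemma dominated_Rintegrable (f g : T -> R) : measurable_fun setT f ->
  (forall x, `|f x| <= g x) -> m.-integrable setT (EFin \o g) ->
  m.-integrable setT (EFin \o f).
Proof.
move=> mf fg; apply: le_integrable => //; first exact/measurable_EFinP.
by move=> x _ /=; rewrite lee_fin (le_trans (fg x))// ler_norm.
Qed.

Variables (a e : T -> R) (delta : R).
Hypotheses (ma : measurable_fun setT a) (me : measurable_fun setT e).
Hypothesis ia : m.-integrable setT (EFin \o (fun x => `|a x| * expR (delta * `|e x|))).

(** The gap [delta - s] absorbs the polynomial factor: [((delta - s) * |x|) ^ k] is at most [k!]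
    times its exponential. *)
Lemma expn_expR_le (k : nat) (s x : R) : s < delta ->
  `|x| ^+ k * expR (s * `|x|) <=
  k`!%:R / (delta - s) ^+ k * expR (delta * `|x|).
Proof.
move=> sd; have ds : 0 < delta - s by rewrite subr_gt0.
have -> : delta * `|x| = (delta - s) * `|x| + s * `|x| by ring.
rewrite expRD mulrA ler_wpM2r ?expR_ge0//.
rewrite mulrAC ler_pdivlMr ?exprn_gt0// -exprMn [`|x| * _]mulrC.
by rewrite expr_le_fact_expR// mulr_ge0// ltW.
Qed.

Lemma integrable_expn_bounded (k : nat) (s : R) (g : T -> R) : s < delta ->
  measurable_fun setT g -> (forall x, `|g x| <= expR (s * `|e x|)) ->
  m.-integrable setT (EFin \o (fun x => a x * e x ^+ k * g x)).
Proof.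
move=> sd mg gb.
apply: (@dominated_Rintegrable _
    (fun x => (k`!%:R / (delta - s) ^+ k) * (`|a x| * expR (delta * `|e x|)))).
- by apply: measurable_funM => //; apply: measurable_funM => //;
    exact: measurable_funX.
- move=> x; rewrite !normrM normrX -mulrA [leRHS]mulrCA ler_wpM2l//.
  by apply: le_trans (expn_expR_le k (e x) sd); rewrite ler_wpM2l// exprn_ge0.
- exact: (@integrableZl _ _ _ _ _ measurableT _ _ ia).
Qed.

(** The [k]-th derivative at [t] of the two-sided Laplace transform of [a] along [e]; [emoment k 0]
    is an ordinary moment. *)
Definition emoment (k : nat) (t : R) : R :=
  \int[m]_x (a x * e x ^+ k * expR (t * e x)).

Lemma integrable_emoment k t : `|t| < delta ->
  m.-integrable setT (EFin \o (fun x => a x * e x ^+ k * expR (t * e x))).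
Proof.
move=> td; apply: (@integrable_expn_bounded _ _ _ td).
  by apply: measurableT_comp => //; exact: measurable_funM.
move=> x; rewrite ger0_norm ?expR_ge0// ler_expR.
by rewrite -normrM ler_norm.
Qed.

Lemma derive1_emoment k t : `|t| < delta ->
  (emoment k)^`() t = emoment k.+1 t.
Proof.
(* The midpoint of [|t|] and [delta]: on []-s, s[] a single multiple of the given integrable
   function dominates every derivative in [t]. *)
move=> td; pose s := (`|t| + delta) / 2.
have sd : s < delta by rewrite /s; lra.
have ts : `|t| < s by rewrite /s; lra.
have nrs u : `]- s, s[ u -> `|u| < s.
  by rewrite /= in_itv/= ltr_norml.
have D u x : is_derive u (1 : R) (fun z : R => a x * e x ^+ k * expR (z * e x))
     (a x * e x ^+ k.+1 * expR (u * e x)).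
  apply: is_derive_eq; rewrite /GRing.scale /=.
  by rewrite exprSr; ring.
have p1 u x : partial1of2 (fun z x => a x * e x ^+ k * expR (z * e x)) u x =
    a x * e x ^+ k.+1 * expR (u * e x).
  by rewrite partial1of2E; apply: derive_val.
rewrite [LHS](@differentiation_under_integral _ _ _ m
  (fun z x => a x * e x ^+ k * expR (z * e x)) setT measurableT t (- s) s _ _ _
  (fun x => (k.+1`!%:R / (delta - s) ^+ k.+1) * (`|a x| * expR (delta * `|e x|)))).
- by apply: eq_Rintegral => x _; rewrite p1.
- by rewrite /= in_itv /= -ltr_norml.
- by move=> u /nrs us; apply: integrable_emoment; exact: lt_trans sd.
- by move=> u x _ _; have [] := D u x.
- by move=> x; rewrite mulr_ge0// ?mulr_ge0 ?expR_ge0// invr_ge0 exprn_ge0//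
    subr_ge0 ltW.
- exact: (@integrableZl _ _ _ _ _ measurableT _ _ ia).
- move=> u x /nrs us _; rewrite p1 !normrM normrX -mulrA [leRHS]mulrCA ler_wpM2l//.
  apply: le_trans (expn_expR_le k.+1 (e x) sd).
  rewrite ler_wpM2l ?exprn_ge0// ger0_norm ?expR_ge0// ler_expR.
  by rewrite (le_trans (ler_norm _))// normrM ler_wpM2r// ltW.
Qed.

(** Term by term integration of a power series dominated by that of the exponential. The partial
    sums of [phi (h * e)] are bounded by [exp (|h| |e|)] with [|h| < delta], so dominated
    convergence applies. It serves for [phi = cos] and [phi = sin]. *)
Lemma cvg_Rintegral_series (c : nat -> R) (phi : R -> R) (k : nat) (h : R) :
  `|h| < delta -> measurable_fun setT phi ->
  (forall j, `|c j| <= j`!%:R^-1) ->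
  (forall x, series (fun j => c j * x ^+ j) @ \oo --> phi x) ->
  series (fun j => c j * h ^+ j * emoment (k + j) 0) @ \oo -->
  \int[m]_x (a x * e x ^+ k * phi (h * e x)).
Proof.
move=> hd mphi cb cphi.
have sb n x : `|series (fun j => c j * x ^+ j) n| <= expR `|x|.
  rewrite /series/= (le_trans (ler_norm_sum _ _ _))//.
  apply: (@le_trans _ _ (series (exp_coeff `|x|) n)).
    rewrite /series/= ler_sum// => j _.
    rewrite normrM normrX mulrC /exp_coeff/= ler_wpM2l ?exprn_ge0//.
  apply: nondecreasing_cvgn_le; last exact: is_cvg_series_exp_coeff.
  by apply/nondecreasing_seqP => j; rewrite /series/= big_nat_recr//= lerDl
    /exp_coeff/= divr_ge0// exprn_ge0.
have d0 : 0 < delta by apply: le_lt_trans hd.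
have hd2 : `|h| < (`|h| + delta) / 2 by lra.
have E n : series (fun j => c j * h ^+ j * emoment (k + j) 0) n =
    \int[m]_x (a x * e x ^+ k * series (fun j => c j * (h * e x) ^+ j) n).
  elim: n => [|n IH].
    rewrite /series/= big_geq//.
    under eq_Rintegral do rewrite big_geq// mulr0.
    by rewrite Rintegral_cst// mul0r.
  rewrite seriesSr IH.
  under [RHS]eq_Rintegral do rewrite seriesSr mulrDr.
  rewrite RintegralD//; last 2 first.
  - apply: (@integrable_expn_bounded k `|h|) => //.
      apply: measurable_sum => j; apply: measurable_funM => //.
      by apply: measurable_funX; exact: measurable_funM.
    by move=> x; rewrite (le_trans (sb _ _))// normrM.
  - apply: (@integrable_expn_bounded k `|h|) => //.
      apply: measurable_funM => //.
      by apply: measurable_funX; exact: measurable_funM.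
    move=> x; rewrite -normrM [leLHS]normrM normrX.
    apply: (@le_trans _ _ (n`!%:R^-1 * (n`!%:R * expR `|h * e x|))).
      by rewrite ler_pM// ?exprn_ge0// expr_le_fact_expR.
    by rewrite mulKf ?mul1r// pnatr_eq0 -lt0n fact_gt0.
  congr +%R; rewrite /emoment -RintegralZl//; last first.
    by apply: integrable_emoment; rewrite normr0.
  apply: eq_Rintegral => x _; rewrite mul0r expR0 mulr1 exprD exprMn; ring.
rewrite (funext E : series _ = _).
apply: fine_cvg; rewrite fineK; last first.
  apply: integrable_fin_num => //.
  apply: (@integrable_expn_bounded k `|h|) => //.
    by apply: measurableT_comp => //; exact: measurable_funM.
  move=> x; rewrite -normrM.
  have /cvg_norm := cphi (h * e x).
  by move/cvgr_to_le; apply; near=> n; exact: sb.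
have := @dominated_convergence _ T R m setT measurableT
  (fun n x => (a x * e x ^+ k * series (fun j => c j * (h * e x) ^+ j) n)%:E)
  (fun x => (a x * e x ^+ k * phi (h * e x))%:E)
  (EFin \o (fun x => `|a x| * `|e x| ^+ k * expR (`|h| * `|e x|))).
case.
- move=> n; apply/measurable_EFinP; apply: measurable_funM.
    by apply: measurable_funM => //; exact: measurable_funX.
  apply: measurable_sum => j; apply: measurable_funM => //.
  by apply: measurable_funX; exact: measurable_funM.
- apply/measurable_EFinP; apply: measurable_funM.
    by apply: measurable_funM => //; exact: measurable_funX.
  by apply: measurableT_comp => //; exact: measurable_funM.
- apply: aeW => x _; apply/cvg_EFin; first by near=> n.
  by apply: cvgMr; exact: cphi.
- have : m.-integrable setT
      (EFin \o (fun x => a x * e x ^+ k * expR (`|h| * `|e x|))).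
    apply: (@integrable_expn_bounded k `|h|) => //.
      by apply: measurableT_comp => //; apply: measurable_funM => //;
        exact: measurableT_comp.
    by move=> x; rewrite ger0_norm ?expR_ge0.
  move/integrable_norm; apply: eq_integrable => // x _ /=.
  by rewrite !normrM normrX (ger0_norm (expR_ge0 _)).
- by apply: aeW => x n _ /=; rewrite lee_fin !normrM normrX ler_wpM2l// -normrM.
by move=> _ _.
Unshelve. all: by end_near.
Qed.

End exponential_moments.

Section moments.
Context {R : realType} {d : measure_display} {T : measurableType d}.
Variables (m : {measure set T -> \bar R}) (a e : T -> R).

Definition exp_dominated (delta : R) : Prop :=
  measurable_fun setT a /\
  m.-integrable setT (EFin \o (fun x => `|a x| * expR (delta * `|e x|))).

Definition moment (k : nat) : R := \int[m]_x (a x * e x ^+ k).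

End moments.

(** * From equal Laplace transforms near 0 to equal Fourier transforms *)

Section laplace_fourier.
Context {R : realType} {d1 d2 : measure_display}.
Context {T1 : measurableType d1} {T2 : measurableType d2}.
Variables (m1 : {measure set T1 -> \bar R}) (m2 : {measure set T2 -> \bar R}).
Variables (e1 : T1 -> R) (e2 : T2 -> R) (delta : R).
Hypotheses (me1 : measurable_fun setT e1) (me2 : measurable_fun setT e2).
Hypothesis delta0 : 0 < delta.

Local Notation dominated m a e := (exp_dominated m a e delta).

Lemma dominatedM d (T : measurableType d) (m : {measure set T -> \bar R})
    (a e b : T -> R) :
  dominated m a e -> measurable_fun setT e -> measurable_fun setT b ->
  (forall x, `|b x| <= 1) -> dominated m (fun x => a x * b x) e.
Proof.
move=> [ma ia] me mb b1; split; first exact: measurable_funM.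
apply: dominated_Rintegrable ia.
  apply: measurable_funM; first by apply: measurableT_comp => //; exact: measurable_funM.
  by apply: measurableT_comp => //; apply: measurable_funM => //; exact: measurableT_comp.
move=> x; rewrite ger0_norm ?mulr_ge0 ?expR_ge0// ler_wpM2r ?expR_ge0//.
by rewrite normrM ler_piMr.
Qed.

Lemma emoment0E d (T : measurableType d) (m : {measure set T -> \bar R})
    (a e : T -> R) k : emoment m a e k 0 = moment m a e k.
Proof. by apply: eq_Rintegral => x _; rewrite mul0r expR0 mulr1. Qed.

(** Expanding [phi (h * e)] writes each new moment as a series in the old ones, with the same
    coefficients [c j * h ^ j] on both sides. *)
Lemma eq_moments_Taylor (a1 : T1 -> R) (a2 : T2 -> R)
    (c : nat -> R) (phi : R -> R) (h : R) :
  dominated m1 a1 e1 -> dominated m2 a2 e2 ->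
  `|h| < delta -> measurable_fun setT phi ->
  (forall j, `|c j| <= j`!%:R^-1) ->
  (forall x, series (fun j => c j * x ^+ j) @ \oo --> phi x) ->
  (forall k, moment m1 a1 e1 k = moment m2 a2 e2 k) ->
  forall k, moment m1 (fun x => a1 x * phi (h * e1 x)) e1 k =
            moment m2 (fun x => a2 x * phi (h * e2 x)) e2 k.
Proof.
move=> [ma1 ia1] [ma2 ia2] hd mphi cb cphi E k.
have /cvg_lim H1 := cvg_Rintegral_series ma1 me1 ia1 (k := k) hd mphi cb cphi.
have /cvg_lim H2 := cvg_Rintegral_series ma2 me2 ia2 (k := k) hd mphi cb cphi.
rewrite /moment.
under eq_Rintegral do rewrite mulrAC.
under [RHS]eq_Rintegral do rewrite mulrAC.
rewrite -H1// -H2//; congr (lim (_ @ \oo)); congr series; apply/funext => j.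
by rewrite !emoment0E E.
Qed.

(** The moments are the derivatives at 0 of the Laplace transforms. The induction proves equality on
    the whole open interval, so that it can be differentiated again. *)
Lemma eq_laplace_eq_moments (a1 : T1 -> R) (a2 : T2 -> R) :
  dominated m1 a1 e1 -> dominated m2 a2 e2 ->
  (forall t, `|t| < delta ->
    \int[m1]_x (a1 x * expR (t * e1 x)) = \int[m2]_x (a2 x * expR (t * e2 x))) ->
  forall k, moment m1 a1 e1 k = moment m2 a2 e2 k.
Proof.
move=> [ma1 ia1] [ma2 ia2] E.
suff H k t : `|t| < delta -> emoment m1 a1 e1 k t = emoment m2 a2 e2 k t.
  by move=> k; rewrite -!emoment0E H// normr0.
elim: k t => [|k IH] t td.
  rewrite /emoment; under eq_Rintegral do rewrite expr0 mulr1.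
  by under [RHS]eq_Rintegral do rewrite expr0 mulr1; exact: E.
rewrite -(derive1_emoment ma1 me1 ia1 _ td) -(derive1_emoment ma2 me2 ia2 _ td).
rewrite !derive1E; apply: near_eq_derive.
have : \forall u \near t, `|u| < delta.
  by apply: (@cvgr_norm_lt _ _ _ (nbhs t) _ id t).
by apply: filterS => u; exact: IH.
Qed.

Lemma integrable_moment d (T : measurableType d) (m : {measure set T -> \bar R})
    (a e : T -> R) k : measurable_fun setT e -> dominated m a e ->
  m.-integrable setT (EFin \o (fun x => a x * e x ^+ k)).
Proof.
move=> me [ma ia]; have := @integrable_emoment _ _ _ m _ _ _ ma me ia k 0.
rewrite normr0 => /(_ delta0); apply: eq_integrable => // x _ /=.
by rewrite mul0r expR0 mulr1.
Qed.

(** Analytic continuation from the real interval [|t| < delta] to the point [i theta], in real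
    terms. The domination holds on the whole strip of half-width [delta], so Taylor expansions
    centred on the imaginary axis reach at least that far, and finitely many steps shorter than
    [delta] lead from 0 to [i theta]. *)
Lemma eq_laplace_eq_fourier (a1 : T1 -> R) (a2 : T2 -> R) (theta : R) :
  dominated m1 a1 e1 -> dominated m2 a2 e2 ->
  (forall t, `|t| < delta ->
    \int[m1]_x (a1 x * expR (t * e1 x)) = \int[m2]_x (a2 x * expR (t * e2 x))) ->
  \int[m1]_x (a1 x * cos (theta * e1 x)) = \int[m2]_x (a2 x * cos (theta * e2 x)).
Proof.
move=> D1 D2 E.
(* Agreement of all derivatives of the two transforms at [i s], split into real and imaginary
   parts. *)
pose agree s := (forall k, moment m1 (fun x => a1 x * cos (s * e1 x)) e1 k =
                           moment m2 (fun x => a2 x * cos (s * e2 x)) e2 k) /\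
                (forall k, moment m1 (fun x => a1 x * sin (s * e1 x)) e1 k =
                           moment m2 (fun x => a2 x * sin (s * e2 x)) e2 k).
have agree0 : agree 0.
  split => k; rewrite /moment.
    under eq_Rintegral do rewrite mul0r cos0 mulr1.
    under [RHS]eq_Rintegral do rewrite mul0r cos0 mulr1.
    exact: eq_laplace_eq_moments.
  under eq_Rintegral do rewrite mul0r sin0 mulr0 mul0r.
  under [RHS]eq_Rintegral do rewrite mul0r sin0 mulr0 mul0r.
  by rewrite !Rintegral_cst// !mul0r.
have mcos := @measurable_cos R; have msin := @measurable_sin R.
have mtrig d (T : measurableType d) (e : T -> R) s : measurable_fun setT e ->
    measurable_fun setT (fun x => cos (s * e x)) /\
    measurable_fun setT (fun x => sin (s * e x)).
  move=> me; split.
    apply: (@measurableT_comp _ _ _ _ _ _ (@cos R)); last exact: measurable_funM.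
    exact: mcos.
  apply: (@measurableT_comp _ _ _ _ _ _ (@sin R)); last exact: measurable_funM.
  exact: msin.
have Dtrig d (T : measurableType d) (m : {measure set T -> \bar R}) (a e : T -> R) s :
    measurable_fun setT e -> dominated m a e ->
    dominated m (fun x => a x * cos (s * e x)) e /\
    dominated m (fun x => a x * sin (s * e x)) e.
  move=> me D; have [? ?] := mtrig _ _ _ s me.
  split; apply: dominatedM => // x; [exact: cos_max|exact: sin_max].
have sumE d (T : measurableType d) (m : {measure set T -> \bar R}) (a e : T -> R) s h k :
    measurable_fun setT e -> dominated m a e ->
    moment m (fun x => a x * cos ((s + h) * e x)) e k =
      moment m (fun x => a x * cos (s * e x) * cos (h * e x)) e k -
      moment m (fun x => a x * sin (s * e x) * sin (h * e x)) e k /\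
    moment m (fun x => a x * sin ((s + h) * e x)) e k =
      moment m (fun x => a x * sin (s * e x) * cos (h * e x)) e k +
      moment m (fun x => a x * cos (s * e x) * sin (h * e x)) e k.
  move=> me D; have [Dc Ds] := Dtrig _ _ _ _ _ s me D.
  have [Dcc Dcs] := Dtrig _ _ _ _ _ h me Dc.
  have [Dsc Dss] := Dtrig _ _ _ _ _ h me Ds.
  split; rewrite /moment.
    rewrite -RintegralB//; [|exact: integrable_moment..].
    by apply: eq_Rintegral => x _; rewrite mulrDl cosD; ring.
  rewrite -RintegralD//; [|exact: integrable_moment..].
  by apply: eq_Rintegral => x _; rewrite mulrDl sinD; ring.
(* [cos_coeff x j] contains the power of [x]; its value at 1 is the bare Taylor coefficient. *)
have ccos (x : R) : series (fun j => cos_coeff 1 j * x ^+ j) @ \oo --> cos x.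
  rewrite (_ : (fun _ => _) = cos_coeff x); first by rewrite cos.unlock; exact: is_cvg_series_cos_coeff.
  by apply/funext => j; rewrite /cos_coeff/= expr1n mulr1 mulrAC.
have csin (x : R) : series (fun j => sin_coeff 1 j * x ^+ j) @ \oo --> sin x.
  rewrite (_ : (fun _ => _) = sin_coeff x); first by rewrite sin.unlock; exact: is_cvg_series_sin_coeff.
  by apply/funext => j; rewrite /sin_coeff/= expr1n mulr1 mulrAC.
have bcos j : `|@cos_coeff R 1 j| <= j`!%:R^-1.
  rewrite /cos_coeff/= expr1n mulr1 normrM (ger0_norm (_ : 0 <= j`!%:R^-1))//.
  by rewrite ler_piMl// normrM normrX normrN1 expr1n mulr1; case: (odd j); rewrite /= ?normr0 ?normr1.
have bsin j : `|@sin_coeff R 1 j| <= j`!%:R^-1.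
  rewrite /sin_coeff/= expr1n mulr1 normrM (ger0_norm (_ : 0 <= j`!%:R^-1))//.
  by rewrite ler_piMl// normrM normrX normrN1 expr1n mulr1; case: (odd j); rewrite /= ?normr0 ?normr1.
have step s h : `|h| < delta -> agree s -> agree (s + h).
  move=> hd [Ac As].
  have [D1c D1s] := Dtrig _ _ _ _ _ s me1 D1.
  have [D2c D2s] := Dtrig _ _ _ _ _ s me2 D2.
  have Cc := eq_moments_Taylor D1c D2c hd mcos bcos ccos Ac.
  have Cs := eq_moments_Taylor D1c D2c hd msin bsin csin Ac.
  have Sc := eq_moments_Taylor D1s D2s hd mcos bcos ccos As.
  have Ss := eq_moments_Taylor D1s D2s hd msin bsin csin As.
  split => k; have [c1 s1] := sumE _ _ m1 a1 e1 s h k me1 D1;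
    have [c2 s2] := sumE _ _ m2 a2 e2 s h k me2 D2.
    by rewrite c1 c2 Cc Ss.
  by rewrite s1 s2 Sc Cs.
have [+ _] : agree theta.
  (* Enough steps to make each of length less than [delta]. *)
  pose n := (Num.trunc (`|theta| / delta)).+1.
  have n0 : 0 < n%:R :> R by rewrite ltr0n.
  have hn : `|theta / n%:R| < delta.
    rewrite normrM normfV (ger0_norm (ltW n0)) ltr_pdivrMr// mulrC.
    by rewrite -ltr_pdivrMr// truncnS_gt.
  have : forall j : nat, agree (theta / n%:R * j%:R).
    elim => [|j IH]; first by rewrite mulr0.
    by rewrite -natr1 mulrDr mulr1; exact: step.
  by move=> /(_ n); rewrite divfK// gt_eqF.
move=> /(_ 0%N); rewrite /moment.
under eq_Rintegral do rewrite expr0 mulr1.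
by under [RHS]eq_Rintegral do rewrite expr0 mulr1.
Qed.
End laplace_fourier.

(** * Gaussian integrals *)

Section affine_change.
Context {R : realType}.
Local Notation mu := (@lebesgue_measure R).
Local Open Scope ereal_scope.

Lemma measurable_affine (a b : R) :
  measurable_fun setT (fun x : R => (a * x + b)%R).
Proof. by apply: measurable_funD => //; exact: measurable_funM. Qed.

(** The rescaled image measure agrees with Lebesgue measure on half-open intervals, and these
    determine it. *)
Lemma lebesgue_measure_affine (a b : R) (A : set R) : (0 < a)%R -> measurable A ->
  mu A = a%:E * pushforward mu (fun x : R => (a * x + b)%R) A.
Proof.
move=> a0 mA.
pose m : {measure set (measurableTypeR R) -> \bar R} :=
  measure_function_pushforward__canonical__measure_function_Measure mu
    (measurable_affine a b : measurable_fun setT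
      ((fun x : R => (a * x + b)%R) : measurableTypeR R -> measurableTypeR R)).
have a0' : (0 <= a)%R by exact: ltW.
rewrite (@lebesgue_measure_unique R (mscale (NngNum a0') m)) //.
move=> _ [[c d]] _ <- /=; rewrite /mscale/= /pushforward.
rewrite (_ : _ @^-1` _ = `](c - b) / a, (d - b) / a]%classic)%R; last first.
  apply/seteqP; split => x /=; rewrite !in_itv/= ltr_pdivrMr// ler_pdivlMr// ltrBlDr lerBrDr (mulrC x);
  by [].
rewrite !lebesgue_measure_itv/= !lte_fin ltr_pM2r ?invr_gt0// ltrD2r.
case: ifP => _; last by rewrite mule0.
by rewrite -EFinB -EFinM -mulrBl mulrC divfK ?gt_eqF//; congr (_%:E); ring.
Qed.

Lemma ge0_integralN (f : R -> \bar R) :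
  measurable_fun setT f -> (forall x, 0 <= f x) ->
  \int[mu]_x f (- x)%R = \int[mu]_x f x.
Proof.
move=> mf f0.
pose opp : measurableTypeR R -> measurableTypeR R := -%R.
have mopp : measurable_fun setT opp by exact: (@oppr_measurable R setT).
transitivity (\int[pushforward mu opp]_x f x).
  by rewrite (ge0_integral_pushforward mopp)//= preimage_setT.
by apply: eq_measure_integral => //= A mA _; exact: lebesgue_measureN.
Qed.

Lemma ge0_integral_affine (a b : R) (f : R -> \bar R) : a != 0%R ->
  measurable_fun setT f -> (forall x, 0 <= f x) ->
  \int[mu]_x f (a * x + b)%R = (`|a|^-1)%:E * \int[mu]_x f x.
Proof.
move=> a0 mf f0.
(* A negative slope is reduced to a positive one by the reflection [x -> - x]. *)
wlog {a0} a0 : a f mf f0 / (0 < a)%R.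
  move=> H; have [ap|] := ltP 0%R a; first exact: H.
  rewrite le_eqVlt (negbTE a0)/= => an.
  rewrite -ge0_integralN//; last first.
    by apply: measurableT_comp => //; exact: measurable_affine.
  under eq_integral do rewrite mulrN -mulNr.
  by rewrite -(normrN a) H// oppr_gt0.
rewrite ger0_norm ?(ltW a0)//.
pose phi : measurableTypeR R -> measurableTypeR R := fun x => (a * x + b)%R.
have mphi : measurable_fun setT phi by exact: measurable_affine.
have a0' : (0 <= a)%R by exact: ltW.
transitivity (\int[pushforward mu phi]_x f x).
  by rewrite (ge0_integral_pushforward mphi)//= preimage_setT.
have -> : \int[mu]_x f x = a%:E * \int[pushforward mu phi]_x f x.
  rewrite -(@ge0_integral_mscale _ _ _
    (measure_function_pushforward__canonical__measure_function_Measure mu mphi)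
    setT measurableT (NngNum a0') f)//.
  by apply: eq_measure_integral => A mA _; exact: lebesgue_measure_affine.
by rewrite muleA -EFinM mulVf ?gt_eqF// mul1e.
Qed.

End affine_change.

Section gaussian.
Context {R : realType}.
Local Notation mu := (@lebesgue_measure R).

Lemma integrable_gaussian (A : R) : 0 < A ->
  mu.-integrable setT (EFin \o (fun x => expR (- (A * x ^+ 2)))).
Proof.
move=> A0; have mg : measurable_fun setT (fun x : R => expR (- (A * x ^+ 2))).
  by apply: measurableT_comp => //; apply: measurableT_comp => //; exact: measurable_funM.
apply/integrableP; split; first exact/measurable_EFinP.
under eq_integral do rewrite /= ger0_norm ?expR_ge0//.
have sA : Num.sqrt A != 0 by rewrite sqrtr_eq0 -ltNge.
have E (x : R) : (expR (- (A * x ^+ 2)))%:E = (gauss_fun (Num.sqrt A * x + 0))%:E.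
  by rewrite addr0 /gauss_fun exprMn sqr_sqrtr ?ltW.
under eq_integral do rewrite E.
rewrite (@ge0_integral_affine _ _ _ (EFin \o gauss_fun))//=.
- by rewrite integralT_gauss -EFinM ltry.
- by apply/measurable_EFinP; exact: measurable_gauss_fun.
- by move=> x; rewrite lee_fin gauss_fun_ge0.
Qed.

Lemma integrable_gaussian_expR (A s : R) : 0 < A ->
  mu.-integrable setT (EFin \o (fun x => expR (- (A * x ^+ 2)) * expR (s * `|x|))).
Proof.
move=> A0.
(* Half of the quadratic exponent absorbs the linear one; completing the square leaves the constant
   [exp (s^2 / (2 A))]. *)
have A20 : 0 < A / 2 by lra.
have := @integrableZl _ _ _ _ _ measurableT (expR (s ^+ 2 / (2 * A))) _ (integrable_gaussian A20).
apply: dominated_Rintegrable.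
  apply: measurable_funM.
    by apply: measurableT_comp => //; apply: measurableT_comp => //; exact: measurable_funM.
  by apply: measurableT_comp => //; apply: measurable_funM => //; exact: measurableT_comp.
move=> x; rewrite -!expRD ger0_norm ?expR_ge0// ler_expR.
rewrite -subr_ge0 -(real_normK (num_real x)).
have -> : s ^+ 2 / (2 * A) + - (A / 2 * `|x| ^+ 2) - (- (A * `|x| ^+ 2) + s * `|x|) =
  (s / A - `|x|) ^+ 2 * (A / 2) by field; lra.
by rewrite mulr_ge0 ?sqr_ge0// ltW.
Qed.

End gaussian.

Section affine_Rintegral.
Context {R : realType}.
Local Notation mu := (@lebesgue_measure R).

Lemma Rintegral_affine (a b : R) (f : R -> R) : a != 0 ->
  mu.-integrable setT (EFin \o f) ->
  \int[mu]_x f (a * x + b) = `|a|^-1 * \int[mu]_x f x.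
Proof.
move=> a0 fi; have mf := measurable_int _ fi.
rewrite /Rintegral integralE [in RHS]integralE.
have P := @ge0_integral_affine R a b ((EFin \o f)^\+)%E a0
  (measurable_funepos mf) (fun _ => funepos_ge0 _ _).
have N := @ge0_integral_affine R a b ((EFin \o f)^\-)%E a0
  (measurable_funeneg mf) (fun _ => funeneg_ge0 _ _).
have fp := integrable_pos_fin_num measurableT fi.
have fn := integrable_neg_fin_num measurableT fi.
have -> : (\int[mu]_x (EFin \o (fun x => f (a * x + b)%R))^\+ x =
    (`|a|^-1)%:E * \int[mu]_x ((EFin \o f)^\+ x))%E.
  by rewrite -P; apply: eq_integral => x _; rewrite !funeposE.
have -> : (\int[mu]_x (EFin \o (fun x => f (a * x + b)%R))^\- x =
    (`|a|^-1)%:E * \int[mu]_x ((EFin \o f)^\- x))%E.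
  by rewrite -N; apply: eq_integral => x _; rewrite !funenegE.
by rewrite -muleBr ?fin_num_adde_defr// fineM// fin_numB fp fn.
Qed.

End affine_Rintegral.

(** * The Fourier transform of a Gaussian, through a differential equation *)

Section gaussian_fourier.
Context {R : realType}.
Local Notation mu := (@lebesgue_measure R).
Variable A : R.
Hypothesis A0 : 0 < A.

Let g (x : R) : R := expR (- (A * x ^+ 2)).

Let mg : measurable_fun setT g.
Proof.
by apply: measurableT_comp => //; apply: measurableT_comp => //; exact: measurable_funM.
Qed.

Let msin y : measurable_fun setT (fun x : R => sin (y * x)).
Proof. by apply: measurableT_comp; [exact: measurable_sin|exact: measurable_funM]. Qed.

Let mcos y : measurable_fun setT (fun x : R => cos (y * x)).
Proof. by apply: measurableT_comp; [exact: measurable_cos|exact: measurable_funM]. Qed.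

Let g_sin_exp s y : mu.-integrable setT
  (EFin \o (fun x => `|g x * sin (y * x)| * expR (s * `|x|))).
Proof.
apply: dominated_Rintegrable (integrable_gaussian_expR s A0).
  apply: measurable_funM.
    by apply: measurableT_comp => //; apply: measurable_funM; [exact: mg|exact: msin].
  by apply: measurableT_comp => //; apply: measurable_funM => //; exact: measurableT_comp.
move=> x; rewrite ger0_norm ?mulr_ge0 ?expR_ge0// ler_wpM2r ?expR_ge0//.
by rewrite normrM ger0_norm ?expR_ge0// ler_piMr ?expR_ge0// sin_max.
Qed.

Let ig (h : R -> R) : measurable_fun setT h -> (forall x, `|h x| <= 1) ->
  mu.-integrable setT (EFin \o (fun x => g x * h x)).
Proof.
move=> mh h1; apply: dominated_Rintegrable (integrable_gaussian A0).
  exact: measurable_funM.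
by move=> x; rewrite normrM ger0_norm ?expR_ge0// ler_piMr ?expR_ge0.
Qed.

Let G y := \int[mu]_x (g x * cos (y * x)).

Lemma Rintegral_gaussian_sin y : \int[mu]_x (g x * sin (y * x)) = 0.
Proof.
have i1 : mu.-integrable setT (EFin \o (fun x => g x * sin (y * x))).
  by apply: ig => // x; exact: sin_max.
have N1 : (-1 : R) != 0 by rewrite oppr_eq0 oner_eq0.
have := Rintegral_affine 0 N1 i1.
under eq_Rintegral do
  rewrite addr0 mulN1r mulrN sinN mulrN /g sqrrN -/(g _) -mulN1r.
rewrite RintegralZl// normrN normr1 invr1 mul1r mulN1r => /eqP.
by rewrite eq_sym -subr_eq0 opprK -mulr2n mulrn_eq0/= => /eqP.
Qed.

(** Translating by [t / (2 A)] completes the square and turns [g x * exp (t x)] into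
    [exp (t^2 / (4 A)) * g x]. The addition formula then leaves [G y] and a sine integral, which is
    zero by oddness. *)
Let G_shift t y : \int[mu]_x (g x * sin (y * x) * expR (t * x)) =
  expR (t ^+ 2 / (4 * A)) * sin (y * (t / (2 * A))) * G y.
Proof.
have i1 : mu.-integrable setT (EFin \o (fun x => g x * sin (y * x) * expR (t * x))).
  apply: dominated_Rintegrable (g_sin_exp `|t| y).
    apply: measurable_funM; first by apply: measurable_funM; [exact: mg|exact: msin].
    by apply: measurableT_comp => //; exact: measurable_funM.
  move=> x; rewrite normrM ler_wpM2l// ger0_norm ?expR_ge0// ler_expR -normrM.
  exact: ler_norm.
have := Rintegral_affine (t / (2 * A)) (oner_neq0 R) i1.
rewrite normr1 invr1 mul1r => <-.
pose w := t / (2 * A).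
have E x : g (1 * x + w) * sin (y * (1 * x + w)) * expR (t * (1 * x + w)) =
   expR (t ^+ 2 / (4 * A)) * cos (y * w) * (g x * sin (y * x)) +
   expR (t ^+ 2 / (4 * A)) * sin (y * w) * (g x * cos (y * x)).
  rewrite mul1r mulrAC (mulrDr y) sinD /g -expRD addrC.
  have -> : t * (x + w) - A * (x + w) ^+ 2 = t ^+ 2 / (4 * A) - A * x ^+ 2.
    by rewrite /w; field; rewrite gt_eqF.
  by rewrite expRD; ring.
under eq_Rintegral do rewrite -/w E.
rewrite RintegralD//.
- rewrite !RintegralZl//; last 2 first.
  + by apply: ig => // x; exact: cos_max.
  + by apply: ig => // x; exact: sin_max.
  by rewrite Rintegral_gaussian_sin mulr0 add0r.
- have : mu.-integrable setT (EFin \o (fun x => g x * sin (y * x))).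
    by apply: ig => // x; exact: sin_max.
  by move/(@integrableZl _ _ _ _ _ measurableT (expR (t ^+ 2 / (4 * A)) * cos (y * w))).
- have : mu.-integrable setT (EFin \o (fun x => g x * cos (y * x))).
    by apply: ig => // x; exact: cos_max.
  by move/(@integrableZl _ _ _ _ _ measurableT (expR (t ^+ 2 / (4 * A)) * sin (y * w))).
Qed.

(** The derivative of [G_shift] in [t] at 0; this takes the place of an integration by parts. *)
Let G_moment y : \int[mu]_x (g x * sin (y * x) * x) = y / (2 * A) * G y.
Proof.
have ms : measurable_fun setT (fun x => g x * sin (y * x)).
  by apply: measurable_funM; [exact: mg|exact: msin].
have := @derive1_emoment R _ _ mu _ id 1 ms (@measurable_id _ _ _) (g_sin_exp 1 y) 0 0.
rewrite normr0 => /(_ ltr01).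
have -> : emoment mu (fun x => g x * sin (y * x)) id 1 0 = \int[mu]_x (g x * sin (y * x) * x).
  by apply: eq_Rintegral => x _; rewrite mul0r expR0 mulr1 expr1.
move=> <-.
have -> : emoment mu (fun x => g x * sin (y * x)) id 0 =
    (fun t => expR (t ^+ 2 / (4 * A)) * sin (y * (t / (2 * A))) * G y).
  apply/funext => t; rewrite -G_shift; apply: eq_Rintegral => x _.
  by rewrite expr0 mulr1.
rewrite derive1E; apply/esym.
have H : is_derive (0:R) (1:R) (fun t => expR (t ^+ 2 / (4 * A)) * sin (y * (t / (2 * A))) * G y)
   (y / (2 * A) * G y).
  apply: is_derive_eq; rewrite /GRing.scale/= expr0n/= !mul0r !mulr0 cos0 expR0 sin0; ring.
by have [] := H.
Qed.

(** Differentiation under the integral sign gives minus the integral in [G_moment]; the inequality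
    [|x| <= exp |x|] supplies the dominating function. *)
Let G_derive y : is_derive y (1:R) G (- (y / (2 * A) * G y)).
Proof.
have D u x : is_derive u (1 : R) (fun z : R => g x * cos (z * x))
     (- (g x * sin (u * x) * x)).
  by apply: is_derive_eq; rewrite /GRing.scale /=; ring.
have p1 u x : partial1of2 (fun z x => g x * cos (z * x)) u x =
    - (g x * sin (u * x) * x).
  by rewrite partial1of2E; apply: derive_val.
have dom u x : `|- (g x * sin (u * x) * x)| <= g x * expR (1 * `|x|).
  rewrite normrN !normrM ger0_norm ?expR_ge0// -mulrA ler_wpM2l ?expR_ge0//.
  rewrite mul1r -[leRHS]mul1r ler_pM// ?sin_max//.
  by apply: le_trans (expR_ge1Dx _); rewrite lerDr.
have ic z : mu.-integrable setT (EFin \o (fun x => g x * cos (z * x))).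
  by apply: ig => // x; exact: cos_max.
have yI : `](y - 1), (y + 1)[ y by rewrite /= in_itv/=; lra.
have gi := integrable_gaussian_expR 1 A0.
have Dp : derivable G y 1.
  apply: (@derivable_under_integral _ _ _ mu (fun z x => g x * cos (z * x)) setT
    measurableT y (y - 1) (y + 1) yI _ _ (fun x => g x * expR (1 * `|x|))) => //.
  - by move=> x; rewrite mulr_ge0 ?expR_ge0.
  - by move=> u x _ _; rewrite p1.
apply: DeriveDef => //; rewrite -derive1E.
transitivity (\int[mu]_x partial1of2 (fun z x => g x * cos (z * x)) y x); last first.
  under eq_Rintegral do rewrite p1 -mulN1r.
  rewrite RintegralZl// ?mulN1r ?G_moment//.
  apply: dominated_Rintegrable gi.
    by apply: measurable_funM => //; apply: measurable_funM; [exact: mg|exact: msin].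
  by move=> x; rewrite -normrN.
apply: (@differentiation_under_integral _ _ _ mu (fun z x => g x * cos (z * x)) setT
    measurableT y (y - 1) (y + 1) yI _ _ (fun x => g x * expR (1 * `|x|))) => //.
- by move=> x; rewrite mulr_ge0 ?expR_ge0.
- by move=> u x _ _; rewrite p1.
Qed.

(** By [G_derive], the product [exp (y^2 / (4 A)) * G y] has derivative zero, so it keeps its value
    at [y = 0]. *)
Lemma gaussian_fourier y :
  \int[mu]_x (g x * cos (y * x)) = expR (- (y ^+ 2 / (4 * A))) * \int[mu]_x g x.
Proof.
have D z : is_derive z (1:R) (fun y => expR (y ^+ 2 / (4 * A)) * G y) 0.
  have := G_derive z => GD.
  by apply: is_derive_eq; rewrite /GRing.scale/=; field; rewrite gt_eqF.
have := is_derive_0_is_cst y 0 D.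
rewrite expr0n/= mul0r expR0 mul1r => H.
have -> : \int[mu]_x g x = G 0.
  by apply: eq_Rintegral => x _; rewrite mul0r cos0 mulr1.
by rewrite -H expRN mulKf// gt_eqF ?expR_gt0.
Qed.

End gaussian_fourier.

(** * Hardy's uncertainty principle for positive measures *)

(** A named copy of the counting measure to which a sigma-finite instance is attached: sums over the
    degree of a power series become integrals and can enter product measures. *)
Definition nat_counting (R : realType) : set nat -> \bar R := @counting nat R.
HB.instance Definition _ (R : realType) := Measure.on (@nat_counting R).
HB.instance Definition _ (R : realType) :=
  @Measure_isSigmaFinite.Build _ _ _ (@nat_counting R) (sigma_finite_counting R).

Lemma measurable_fun_nat_prod d d' (T : measurableType d) (U : measurableType d')
    (h : T * nat -> U) :
  (forall k, measurable_fun setT (fun x => h (x, k))) -> measurable_fun setT h.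
Proof.
move=> mh _ Y mY; rewrite setTI.
rewrite (_ : h @^-1` Y =
    \bigcup_k (((fun x => h (x, k)) @^-1` Y) `*` [set k])); last first.
  apply/seteqP; split => [[x k] /= hY|[x k] [n _ [/= hY ->]]//].
  by exists k.
apply: bigcupT_measurable => k; apply: measurableX => //.
by rewrite -[X in measurable X]setTI; exact: mh.
Qed.

Lemma nneseries_cvg_series (R : realType) (u : nat -> R) (l : R) :
  series u @ \oo --> l -> (\sum_(0 <= k <oo) (u k)%:E)%E = l%:E.
Proof.
move=> ul; apply/cvg_lim => //.
rewrite (_ : (fun n => _) = EFin \o series u); last first.
  by apply/funext => n; rewrite /= /series/= -sumEFin.
by apply/cvg_EFin; [near=> n|].
Unshelve. all: by end_near.
Qed.

Lemma cvg_exp_series (R : realType) (x : R) :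
  series (fun k => x ^+ k / k`!%:R) @ \oo --> expR x.
Proof. by rewrite /expR; exact: is_cvg_series_exp_coeff. Qed.

(** * Exponential series as integrals over a product with [nat] *)

Section exponential_series.
Context {R : realType} {d : measure_display} {T : measurableType d}.
Variable m : {sigma_finite_measure set T -> \bar R}.
Variables (W X : T -> R) (A r : R).
Hypotheses (mW : measurable_fun setT W) (mX : measurable_fun setT X).
Hypothesis X0 : forall x, 0 <= X x.
Hypothesis iW : m.-integrable setT (EFin \o (fun x => W x * expR (`|r| * X x))).

(** The Taylor terms of [W * exp (- X)]. Multiplied by [r ^ k] and summed over [k] they give
    [W * exp (- r X)], so a power series in [r] is an integral over [T * nat]. *)
Definition exp_terms (z : T * nat) : R := W z.1 * ((- X z.1) ^+ z.2 / z.2`!%:R).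

Let f (z : T * nat) : R := exp_terms z * (A * r ^+ z.2).

Lemma measurable_exp_terms : measurable_fun setT exp_terms.
Proof.
apply: measurable_fun_nat_prod => k; apply: measurable_funM => //=.
apply: measurable_funM => //=.
by apply: (@measurable_funX _ _ _ _ (fun x => - X x)); exact: measurableT_comp.
Qed.

Let mf : measurable_fun setT f.
Proof.
apply: measurable_funM; first exact: measurable_exp_terms.
by apply: measurable_fun_nat_prod => k /=; exact: measurable_cst.
Qed.

Let sum_abs x : (\int[@nat_counting R]_k `|f (x, k)|%:E =
  (`|A| * `|W x * expR (`|r| * X x)|)%:E)%E.
Proof.
rewrite [LHS]ge0_integral_count//; apply: nneseries_cvg_series.
rewrite normrM (ger0_norm (expR_ge0 _)) mulrA.
rewrite (_ : (fun _ => _) =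
    (fun k => (`|A| * `|W x|) * ((`|r| * X x) ^+ k / k`!%:R))); last first.
  apply/funext => k; rewrite /f/exp_terms/= !normrM !normrX normrN normfV.
  by rewrite (ger0_norm (X0 x)) (ger0_norm (ler0n _ _)) exprMn; ring.
rewrite (_ : series _ = (fun n => `|A| * `|W x| * series (fun k => (`|r| * X x) ^+ k / k`!%:R) n)).
  by apply: cvgMr; exact: cvg_exp_series.
by apply/funext => n; rewrite /series/= mulr_sumr.
Qed.

Lemma integrable_exp_terms : (m \x @nat_counting R)%E.-integrable setT
  (EFin \o (fun z => exp_terms z * (A * r ^+ z.2))).
Proof.
apply/integrable12ltyP; first by apply/measurable_EFinP.
under eq_integral do rewrite sum_abs.
have := @integrableZl _ _ _ _ _ measurableT `|A| _ (integrable_norm iW).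
by move/integrable_lty; apply.
Qed.

(** Fubini with the sum over [k] taken first; absolute summability, from [sum_abs], identifies the
    counting integral with the limit of the exponential series. *)
Lemma Rintegral_exp_terms :
  \int[(m \x @nat_counting R)%E]_z (exp_terms z * (A * r ^+ z.2)) =
  A * \int[m]_x (W x * expR (- (r * X x))).
Proof.
have iW' : m.-integrable setT (EFin \o (fun x => W x * expR (- (r * X x)))).
  apply: dominated_Rintegrable (integrable_norm iW).
    apply: measurable_funM => //; apply: measurableT_comp => //.
    by apply: measurableT_comp => //; exact: measurable_funM.
  move=> x /=; rewrite !normrM ler_wpM2l// !(ger0_norm (expR_ge0 _)) ler_expR.
  rewrite -mulNr ler_wpM2r// -normrN; exact: ler_norm.
rewrite -RintegralZl// /Rintegral -integral12_prod_meas1; last exact: integrable_exp_terms.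
congr fine; apply: eq_integral => x _; rewrite /fubini_F/=.
have sx : summable setT (fun k => (f (x, k))%:E).
  rewrite summableE -(@nneseries_esumT _ (fun k => `|(f (x, k))%:E|)%E)//.
  rewrite -ge0_integral_count//; have := sum_abs x; rewrite /nat_counting /= => ->.
  by [].
rewrite [LHS](integral_count sx); apply: nneseries_cvg_series.
rewrite (_ : series _ = (fun n => A * W x * series (fun k => (- (r * X x)) ^+ k / k`!%:R) n)).
  by rewrite mulrA; apply: cvgMr; exact: cvg_exp_series.
apply/funext => n; rewrite /series/= mulr_sumr; apply: eq_bigr => k _.
by rewrite /f /exp_terms /= -mulrN exprMn; ring.
Qed.

End exponential_series.

Lemma cos_pi_natr (R : realType) (k : nat) : cos (pi * k%:R) = (-1) ^+ k :> R.
Proof.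
elim: k => [|k IH]; first by rewrite mulr0 cos0.
by rewrite -natr1 mulrDr mulr1 cosDpi IH exprS mulN1r.
Qed.

(** * Exchange of integrals under a product bound *)

Section fubini_dominated.
Context {R : realType} {d1 d2 : measure_display}.
Context {T1 : measurableType d1} {T2 : measurableType d2}.
Variables (m1 : {sigma_finite_measure set T1 -> \bar R}).
Variables (m2 : {sigma_finite_measure set T2 -> \bar R}).

Lemma Rintegral_Fubini_dominated (f : T1 * T2 -> R) (a : T1 -> R) (b : T2 -> R) :
  measurable_fun setT f ->
  m1.-integrable setT (EFin \o a) -> m2.-integrable setT (EFin \o b) ->
  (forall x y, `|f (x, y)| <= a x * b y) ->
  \int[m1]_x \int[m2]_y f (x, y) = \int[m2]_y \int[m1]_x f (x, y).
Proof.
move=> mf ia ib fab.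
have i2 x : m2.-integrable setT (EFin \o (fun y => f (x, y))).
  apply: dominated_Rintegrable (@integrableZl _ _ _ _ _ measurableT (a x) _ ib).
    by apply: (measurableT_comp mf); exact: pair1_measurable.
  by move=> y; exact: fab.
have i1 y : m1.-integrable setT (EFin \o (fun x => f (x, y))).
  apply: dominated_Rintegrable (@integrableZl _ _ _ _ _ measurableT (b y) _ ia).
    by apply: (measurableT_comp mf); exact: pair2_measurable.
  by move=> x; rewrite /= mulrC; exact: fab.
have ih : (m1 \x m2)%E.-integrable setT (EFin \o f).
  apply/integrable12ltyP; first by apply/measurable_EFinP.
  have iab := @integrableZl _ _ _ _ _ measurableT (\int[m2]_y `|b y|) _ (integrable_norm ia).
  apply: le_lt_trans (integrable_lty measurableT iab).
  have mabs : measurable_fun setT (fun z => `|f z|%:E).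
    by apply/measurable_EFinP; exact: measurableT_comp.
  apply: ge0_le_integral => //.
  - by move=> x _; apply: integral_ge0.
  - exact: (@measurable_fun_fubini_tonelli_F _ _ _ _ _ m2 (fun z => `|f z|%:E)).
  - exact: measurable_int iab.
  move=> x _ /=; rewrite -EFinM mulrC -RintegralZl//; last exact: integrable_norm.
  rewrite /Rintegral fineK; last first.
    apply: integrable_fin_num => //.
    exact: (@integrableZl _ _ _ _ _ measurableT `|a x| _ (integrable_norm ib)).
  apply: ge0_le_integral => //.
  - apply/measurable_EFinP; apply: measurableT_comp => //.
    by apply: (measurableT_comp mf); exact: pair1_measurable.
  - by have := @integrableZl _ _ _ _ _ measurableT `|a x| _ (integrable_norm ib); exact: measurable_int.
  by move=> y _; rewrite lee_fin (le_trans (fab x y))// -normrM ler_norm.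
rewrite /Rintegral; congr fine.
transitivity (\int[m1]_x \int[m2]_y (f (x, y))%:E)%E.
  by apply: eq_integral => x _; rewrite fineK//; exact: integrable_fin_num (i2 x).
rewrite (Fubini ih)/=.
by apply: eq_integral => x _; rewrite fineK//; exact: integrable_fin_num (i1 x).
Qed.

End fubini_dominated.

Section hardy.
Context {R : realType} {d : measure_display} {T : measurableType d}.
Variable m : {sigma_finite_measure set T -> \bar R}.
Local Notation mu := (@lebesgue_measure R).
Variables (w y : T -> R) (gamma sigma C : R).
Hypotheses (mw : measurable_fun setT w) (my : measurable_fun setT y).
Hypothesis w0 : forall x, 0 <= w x.
Hypothesis iw : m.-integrable setT (EFin \o (fun x => w x * expR (sigma * y x ^+ 2))).
Hypothesis sigma0 : 0 < sigma.
Hypothesis slack : 1 < 4 * gamma * sigma.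

Let F (tau : R) := \int[m]_x (w x * cos (tau * y x)).

Hypothesis F_decay : forall tau, `|F tau| <= C * expR (- (gamma * tau ^+ 2)).

Let my2 : measurable_fun setT (fun x => y x ^+ 2). Proof. exact: measurable_funX. Qed.

Let iwb (g : T -> R) : measurable_fun setT g ->
  (forall x, `|g x| <= expR (sigma * y x ^+ 2)) ->
  m.-integrable setT (EFin \o (fun x => w x * g x)).
Proof.
move=> mg gb; apply: dominated_Rintegrable iw; first exact: measurable_funM.
by move=> x; rewrite normrM (ger0_norm (w0 x)) ler_wpM2l.
Qed.

Let e1 x : 1 <= expR (sigma * y x ^+ 2).
Proof. by rewrite -expR0 ler_expR mulr_ge0 ?sqr_ge0// ltW. Qed.

Let mcosy tau : measurable_fun setT (fun x => cos (tau * y x)).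
Proof. by apply: measurableT_comp; [exact: measurable_cos|exact: measurable_funM]. Qed.

Let iwcos tau : m.-integrable setT (EFin \o (fun x => w x * cos (tau * y x))).
Proof. by apply: iwb => // x; apply: le_trans (e1 x); exact: cos_max. Qed.

Let w_int : m.-integrable setT (EFin \o w).
Proof.
have := iwb (@measurable_cst _ _ T R setT 1).
move=> /(_ _)/= H; have : m.-integrable setT (EFin \o (fun x => w x * 1)).
  by apply: H => x; rewrite normr1.
by apply: eq_integrable => // x _ /=; rewrite mulr1.
Qed.

Let mF : measurable_fun setT F.
Proof.
apply: continuous_measurable_fun => t.
apply: (@continuity_under_integral _ _ _ m (fun tau x => w x * cos (tau * y x)) setT
  measurableT (t - 1) (t + 1) _ _ w w_int).
- by move=> tau _; exact: iwcos.
- apply: aeW => x _ u _; apply: cvgM; first exact: cvg_cst.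
  apply: continuous_comp; last exact: continuous_cos.
  by apply: cvgM; [exact: cvg_id|exact: cvg_cst].
- move=> tau _; apply: aeW => x _; rewrite normrM (ger0_norm (w0 x)).
  by rewrite ler_piMr// cos_max.
- by rewrite inE/= in_itv/=; lra.
Qed.

Let iF (g : R -> R) (s : R) : s < gamma -> measurable_fun setT g ->
  (forall tau, `|g tau| <= expR (s * tau ^+ 2)) ->
  mu.-integrable setT (EFin \o (fun tau => F tau * g tau)).
Proof.
move=> sg mg gb.
have gs : 0 < gamma - s by rewrite subr_gt0.
have := @integrableZl _ _ _ _ _ measurableT C _ (integrable_gaussian gs).
apply: dominated_Rintegrable; first exact: measurable_funM.
move=> tau; rewrite normrM.
apply: le_trans (ler_pM (normr_ge0 _) (normr_ge0 _) (F_decay tau) (gb tau)) _.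
rewrite -mulrA -expRD.
by have -> : - (gamma * tau ^+ 2) + s * tau ^+ 2 = - ((gamma - s) * tau ^+ 2) by ring.
Qed.

Let K := \int[mu]_x expR (- (x ^+ 2)).

Let gauss_scale (u : R) : 0 < u ->
  \int[mu]_t expR (- ((4 * u ^+ 2)^-1 * t ^+ 2)) = 2 * u * K.
Proof.
move=> u0.
have u20 : (2 * u)^-1 != 0 by rewrite invr_eq0 mulf_neq0// ?pnatr_eq0// gt_eqF.
have i1 := @integrable_gaussian R 1 ltr01.
have uE : (4 * u ^+ 2)^-1 = (2 * u)^-1 ^+ 2.
  by rewrite exprVn exprMn; congr (_ * _)^-1; ring.
have nu : `|(2 * u)^-1|^-1 = 2 * u.
  by rewrite normfV invrK gtr0_norm// mulr_gt0.
have := Rintegral_affine 0 u20 i1; rewrite nu uE.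
under eq_Rintegral do rewrite addr0 mul1r exprMn.
under [X in _ = _ * X -> _]eq_Rintegral do rewrite mul1r.
by move=> <-.
Qed.

Let K_gt0 : 0 < K.
Proof.
rewrite /K /Rintegral.
have -> : (\int[mu]_x (expR (- x ^+ 2))%:E)%E = (Num.sqrt pi)%:E by exact: integralT_gauss.
by rewrite /= sqrtr_gt0 pi_gt0.
Qed.

(* For real [u] this is Fubini and the Fourier transform of a Gaussian. *)
Let laplace_identity (u : R) : 0 < u ->
  \int[mu]_t (F t * expR (- ((4 * u ^+ 2)^-1 * t ^+ 2))) =
  2 * K * u * \int[m]_x (w x * expR (- (u ^+ 2 * y x ^+ 2))).
Proof.
move=> u0; pose A := (4 * u ^+ 2)^-1.
have A0 : 0 < A by rewrite invr_gt0 mulr_gt0// exprn_gt0.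
pose g t := expR (- (A * t ^+ 2)).
have mg : measurable_fun setT g.
  by apply: measurableT_comp => //; apply: measurableT_comp => //; exact: measurable_funM.
pose h (z : T * measurableTypeR R) : R := w z.1 * (g z.2 * cos (y z.1 * z.2)).
have mh : measurable_fun setT h.
  apply: measurable_funM; first exact: (measurableT_comp mw).
  apply: measurable_funM; first exact: (measurableT_comp mg).
  apply: (measurableT_comp (@measurable_cos R)).
  by apply: measurable_funM => //; exact: (measurableT_comp my).
have FB := Rintegral_Fubini_dominated mh w_int (integrable_gaussian A0) _.
have -> : \int[mu]_t (F t * expR (- (A * t ^+ 2))) = \int[mu]_t \int[m]_x h (x, t).
  apply: eq_Rintegral => t _; rewrite mulrC -RintegralZl//.
  by apply: eq_Rintegral => x _; rewrite /h/= mulrCA [t * _]mulrC.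
rewrite -FB; last first.
  move=> x t; rewrite !normrM (ger0_norm (w0 x)) ler_wpM2l//.
  by rewrite (ger0_norm (expR_ge0 _)) ler_piMr ?expR_ge0// cos_max.
rewrite -RintegralZl//; last first.
  apply: iwb.
    by apply: measurableT_comp => //; apply: measurableT_comp => //; exact: measurable_funM.
  move=> x; apply: le_trans (e1 x); rewrite ger0_norm ?expR_ge0// -expR0 ler_expR.
  by rewrite oppr_le0 mulr_ge0 ?sqr_ge0.
apply: eq_Rintegral => x _; rewrite /h/= RintegralZl//; last first.
  apply: dominated_Rintegrable (integrable_gaussian A0).
    apply: measurable_funM => //; apply: (measurableT_comp (@measurable_cos R)).
    exact: measurable_funM.
  move=> t; rewrite normrM (ger0_norm (expR_ge0 _)).
  by rewrite ler_piMr ?expR_ge0// cos_max.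
rewrite gaussian_fourier// gauss_scale//.
have -> : y x ^+ 2 / (4 * A) = u ^+ 2 * y x ^+ 2.
  by rewrite /A; field; rewrite gt_eqF.
ring.
Qed.

(* Both sides of [laplace_identity], read as functions of a complex [u], are
   Laurent series: odd positive powers on the right, even nonpositive powers on
   the left.  Continued along the half circle [u = rho e^(i theta)], the identity
   at [u = - rho] contradicts the one at [u = rho] unless both sides vanish. *)
Lemma hardy_measure : ae_eq m setT (EFin \o w) (cst 0%E).
Proof.
(* [kappa = 1] is the Gaussian borderline. [E], the harmonic mean of 1 and [kappa], satisfies
   [1 < E] and [E^2 < kappa]; it measures the width of the annulus on which both Laurent series
   converge. *)
pose kappa := 4 * gamma * sigma.
pose E := 2 * kappa / (kappa + 1).
have k1 : 1 < kappa by [].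
have E1 : 1 < E by rewrite /E ltr_pdivlMr; lra.
have E0 : 0 < E by lra.
have EE : E * E < kappa.
  have k10 : 0 < kappa + 1 by lra.
  rewrite /E -subr_gt0.
  have -> : kappa - 2 * kappa / (kappa + 1) * (2 * kappa / (kappa + 1)) =
     kappa * (kappa - 1) ^+ 2 / (kappa + 1) ^+ 2 by field; rewrite gt_eqF.
  by rewrite divr_gt0 ?exprn_gt0// mulr_gt0 ?exprn_gt0//; lra.
pose delta := ln E / 2.
have delta0 : 0 < delta by rewrite divr_gt0// ln_gt0.
have E2delta : expR (2 * delta) = E by rewrite /delta mulrC divfK// lnK.
(* The radius of the half circle. As [rho^2 E = sigma], the weight hypothesis gives convergence up
   to [|u| = rho exp delta]; as [B E = E^2 / (4 sigma) < gamma], the decay of [F] gives it down to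
   [|u| = rho exp (- delta)]. *)
pose rho := Num.sqrt (sigma / E).
have rho0 : 0 < rho by rewrite sqrtr_gt0 divr_gt0.
have rho2 : rho ^+ 2 = sigma / E by rewrite sqr_sqrtr// ltW// divr_gt0.
pose B := (4 * rho ^+ 2)^-1.
have B0 : 0 < B by rewrite invr_gt0 mulr_gt0// exprn_gt0.
have BE : B * E < gamma.
  rewrite /B rho2 -(ltr_pM2r sigma0) -subr_gt0.
  have -> : gamma * sigma - (4 * (sigma / E))^-1 * E * sigma = (kappa - E * E) / 4.
    by rewrite /kappa; field; rewrite !gt_eqF.
  by rewrite divr_gt0// subr_gt0.
(* With [u = rho exp t], the two exponents are [u^2 y^2 = exp (2 t) X1] and
   [tau^2 / (4 u^2) = exp (- 2 t) X2]. *)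
pose X1 x := rho ^+ 2 * y x ^+ 2.
pose X2 (t : R) := B * t ^+ 2.
pose W1 x := 2 * K * rho * w x.
have mX1 : measurable_fun setT X1 by exact: measurable_funM.
have mX2 : measurable_fun (setT : set (measurableTypeR R)) X2.
  exact: (measurable_funM (measurable_cst B) (@exprn_measurable R setT 2)).
have mW1 : measurable_fun setT W1 by exact: measurable_funM.
have X10 x : 0 <= X1 x by rewrite mulr_ge0 ?sqr_ge0.
have X20 x : 0 <= X2 x by rewrite mulr_ge0 ?sqr_ge0// ltW.
have iW1 (r : R) : `|r| <= E -> m.-integrable setT (EFin \o (fun x => W1 x * expR (`|r| * X1 x))).
  move=> rE; have : m.-integrable setT (EFin \o (fun x => w x * expR (`|r| * X1 x))).
    apply: iwb; first by apply: measurableT_comp => //; exact: measurable_funM.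
    move=> x; rewrite ger0_norm ?expR_ge0// ler_expR /X1 mulrA ler_wpM2r ?sqr_ge0//.
    by rewrite rho2 mulrA ler_pdivrMr// mulrC ler_wpM2l// ltW.
  move/(@integrableZl _ _ _ _ _ measurableT (2 * K * rho)).
  by apply: eq_integrable => // x _ /=; rewrite /W1 -EFinM mulrA.
have iF2 (r : R) : `|r| <= E -> mu.-integrable setT (EFin \o (fun t => F t * expR (`|r| * X2 t))).
  move=> rE; apply: (@iF _ (`|r| * B)).
  - by apply: le_lt_trans BE; rewrite mulrC ler_wpM2l// ltW.
  - by apply: measurableT_comp => //; exact: measurable_funM.
  - by move=> t; rewrite ger0_norm ?expR_ge0// mulrA.
have mn d' (U : measurableType d') (c : nat -> R) : measurable_fun setT (fun z : U * nat => c z.2).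
  by apply: measurable_fun_nat_prod => k /=; exact: measurable_cst.
(* The powers of [exp t] carried by the [k]-th terms: odd positive ones for the measure, even
   nonpositive ones for its Fourier transform. Thus the Laurent series in [u] are Laplace transforms
   in [t]. *)
pose f1 (z : T * nat) : R := 2 * z.2%:R + 1.
pose f2 (z : measurableTypeR R * nat) : R := - (2 * z.2%:R).
have mf1 : measurable_fun setT f1 by exact: (mn _ T (fun k => 2 * k%:R + 1)).
have mf2 : measurable_fun setT f2 by exact: (mn _ (measurableTypeR R) (fun k => - (2 * k%:R))).
have ex1 t z : expR (t * f1 z) = expR t * expR (2 * t) ^+ z.2.
  by rewrite -expRM_natr -expRD /f1; congr expR; ring.
have ex2 t z : expR (t * f2 z) = 1 * expR (- (2 * t)) ^+ z.2.
  by rewrite mul1r -expRM_natr /f2; congr expR; ring.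
have mt1 := measurable_exp_terms mW1 mX1.
have mF' : measurable_fun (setT : set (measurableTypeR R)) F := mF.
have mt2 := measurable_exp_terms mF' mX2.
(* Since [exp (delta |f1|) = exp delta * E ^ k], the required domination is absolute convergence of
   the series at [r = E]; likewise for [f2] below. *)
have D1 : exp_dominated (m \x @nat_counting R)%E (exp_terms W1 X1) f1 delta.
  split=> //; have EE' : `|E| <= E by rewrite gtr0_norm.
  have := integrable_norm (integrable_exp_terms (expR delta) mW1 mX1 X10 (iW1 _ EE')).
  apply: eq_integrable => // z _ /=; rewrite normrM.
  have -> : `|f1 z| = f1 z by rewrite ger0_norm// addr_ge0// mulr_ge0.
  by rewrite ex1 E2delta (@ger0_norm _ (expR delta * _)) ?mulr_ge0 ?expR_ge0 ?exprn_ge0 ?ltW.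
have D2 : exp_dominated (mu \x @nat_counting R)%E (exp_terms F X2) f2 delta.
  split=> //; have EE' : `|E| <= E by rewrite gtr0_norm.
  have := integrable_norm (integrable_exp_terms 1 mF' mX2 X20 (iF2 _ EE')).
  apply: eq_integrable => // z _ /=; rewrite normrM.
  have -> : delta * `|f2 z| = z.2%:R * (2 * delta).
    by rewrite normrN ger0_norm ?mulr_ge0//; ring.
  by rewrite expRM_natl E2delta mul1r (@ger0_norm _ (E ^+ _)) ?exprn_ge0 ?ltW.
have small t : `|t| < delta -> expR (2 * t) <= E /\ expR (- (2 * t)) <= E.
  by rewrite ltr_norml => td; rewrite -E2delta !ler_expR; lra.
(* The Laplace identity at [u = rho exp t], before expansion into series. *)
have Lu t : \int[mu]_s (F s * expR (- (expR (- (2 * t)) * X2 s))) =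
    expR t * \int[m]_x (W1 x * expR (- (expR (2 * t) * X1 x))).
  have iw' : m.-integrable setT (EFin \o (fun x => w x * expR (- (expR (2 * t) * X1 x)))).
    apply: iwb.
      by apply: measurableT_comp => //; apply: measurableT_comp => //; exact: measurable_funM.
    move=> x; apply: le_trans (e1 x); rewrite ger0_norm ?expR_ge0// -expR0 ler_expR.
    by rewrite oppr_le0 mulr_ge0 ?expR_ge0.
  have u0 : 0 < rho * expR t by rewrite mulr_gt0 ?expR_gt0.
  have := laplace_identity u0.
  have -> : (4 * (rho * expR t) ^+ 2)^-1 = expR (- (2 * t)) * B.
    by rewrite expRN (expRM_natl 2) /B exprMn -invfM; congr (_^-1); ring.
  under eq_Rintegral do rewrite -mulrA -/(X2 _).
  move=> ->; rewrite [RHS](_ : _ = expR t *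
      (2 * K * rho * \int[m]_x (w x * expR (- (expR (2 * t) * X1 x))))).
    rewrite exprMn -(expRM_natl 2).
    under eq_Rintegral do rewrite [rho ^+ 2 * _]mulrC -mulrA -/(X1 _).
    by ring.
  by congr (_ * _); rewrite -RintegralZl//; apply: eq_Rintegral => x _; rewrite mulrA.
have L t : `|t| < delta ->
    \int[(m \x @nat_counting R)%E]_z (exp_terms W1 X1 z * expR (t * f1 z)) =
    \int[(mu \x @nat_counting R)%E]_z (exp_terms F X2 z * expR (t * f2 z)).
  move=> /small [t1 t2].
  under eq_Rintegral do rewrite ex1.
  under [RHS]eq_Rintegral do rewrite ex2.
  rewrite Rintegral_exp_terms//; last by apply: iW1; rewrite ger0_norm ?expR_ge0.
  rewrite Rintegral_exp_terms//; last by apply: iF2; rewrite ger0_norm ?expR_ge0.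
  by rewrite mul1r Lu.
have EE1 : `|1 : R| <= E by rewrite normr1 ltW.
(* At [t = i pi], that is [u = - rho], odd powers contribute the sign -1 and even powers +1. *)
have cos1 z : cos (pi * f1 z) = -1 * 1 ^+ z.2.
  rewrite expr1n mulr1 /f1 -natrM natr1 cos_pi_natr -signr_odd.
  by rewrite oddS oddM.
have cos2 z : cos (pi * f2 z) = 1 * 1 ^+ z.2.
  by rewrite expr1n mulr1 /f2 mulrN cosN -natrM cos_pi_natr -signr_odd oddM.
have := eq_laplace_eq_fourier mf1 mf2 delta0 pi D1 D2 L.
under eq_Rintegral do rewrite cos1.
under [RHS]eq_Rintegral do rewrite cos2.
rewrite Rintegral_exp_terms//; last exact: iW1.
rewrite Rintegral_exp_terms//; last exact: iF2.
(* Continuation equates minus the first integral with the second, and [Lu 0] equates the two; so the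
   first is zero. Its integrand is nonnegative. *)
have := Lu 0; rewrite mulr0 oppr0 !expR0 !mul1r mulN1r => -> /eqP.
rewrite eq_sym -subr_eq0 opprK -mulr2n mulrn_eq0/= => /eqP I0.
have mW1e : measurable_fun setT (fun x => W1 x * expR (- (1 * X1 x))).
  apply: measurable_funM => //; apply: measurableT_comp => //.
  by apply: measurableT_comp => //; exact: measurable_funM.
have iW1e : m.-integrable setT (EFin \o (fun x => W1 x * expR (- (1 * X1 x)))).
  apply: dominated_Rintegrable (integrable_norm (iW1 _ EE1)) => //.
  move=> x /=; rewrite !normrM ler_wpM2l// !(ger0_norm (expR_ge0 _)) ler_expR normr1 !mul1r.
  by rewrite ge0_cp.
have W10 x : 0 <= W1 x * expR (- (1 * X1 x)).
  by rewrite mulr_ge0 ?expR_ge0// !mulr_ge0// ltW.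
have : (\int[m]_x `|(W1 x * expR (- (1 * X1 x)))%:E| = 0)%E.
  under eq_integral do rewrite gee0_abs ?lee_fin//.
  rewrite -(fineK (integrable_fin_num measurableT iW1e)); congr (_%:E); exact: I0.
move/(ae_eq_integral_abs _ measurableT _).1 => /(_ _)/=.
move=> H; have := H ((measurable_EFinP _ _).2 mW1e).
apply: filterS => x /(_ Logic.I) /= [] /eqP.
rewrite mulf_eq0 expR_eq0 orbF /W1 mulf_eq0.
have /gt_eqF -> /= : 0 < 2 * K * rho by rewrite !mulr_gt0.
by move=> /eqP -> _.
Qed.

End hardy.

(** * Lebesgue measure on tuples *)

Lemma sigma_finite_product d1 d2 (T1 : measurableType d1) (T2 : measurableType d2)
    (R : realType) (m1 : {sigma_finite_measure set T1 -> \bar R})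
    (m2 : {sigma_finite_measure set T2 -> \bar R}) :
  sigma_finite setT (m1 \x m2)%E.
Proof.
have /sigma_finiteP[F [FT Fnd Foo]] := sigma_finiteT m1.
have /sigma_finiteP[G [GT Gnd Goo]] := sigma_finiteT m2.
exists (fun n => F n `*` G n) => [|n]; last first.
  have [mF Fn] := Foo n; have [mG Gn] := Goo n.
  split; first exact: measurableX.
  by rewrite product_measure1E// lte_mul_pinfty// ge0_fin_numE.
apply/esym; rewrite -subTset => -[x y] _.
have : setT x by []. rewrite FT => -[i _ Fx].
have : setT y by []. rewrite GT => -[j _ Gy].
exists (i + j)%N => //; split.
- by move: Fx; apply/subsetPset/Fnd/leq_addr.
- by move: Gy; apply/subsetPset/Gnd/leq_addl.
Qed.

Section lebesgue_tuple.
Context {R : realType}.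
Local Notation mu := (@lebesgue_measure R).

Let consp n (p : measurableTypeR R * n.-tuple R) : n.+1.-tuple R := cons_tuple p.1 p.2.

Let measurable_consp n : measurable_fun setT (@consp n).
Proof.
have := @measurable_cons _ _ (measurableTypeR R * n.-tuple R)%type R fst n snd
  (@measurable_fst _ _ _ _) (@measurable_snd _ _ _ _).
by congr measurable_fun; apply/funext => p; apply/val_inj.
Qed.

(** The gateway from iterated integrals to measure theory. The measure is a Dirac mass at the empty
    tuple for [n = 0]; after that it is the image under [consp] of the product with Lebesgue
    measure, and Tonelli gives the formula. *)
Lemma intn_integral n : exists m : {sigma_finite_measure set (n.-tuple R) -> \bar R},
  forall g : n.-tuple R -> \bar R, measurable_fun setT g -> (forall t, 0 <= g t)%E ->
    intn g = (\int[m]_t g t)%E.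
Proof.
elim: n => [|n [m mE]].
  exists (\d_([tuple] : 0.-tuple R)) => g mg g0.
  by rewrite integral_dirac// diracT mul1e.
pose pm : {measure set (n.+1.-tuple R) -> \bar R} :=
  measure_function_pushforward__canonical__measure_function_Measure
    (mu \x m)%E (@measurable_consp n).
(* An image measure need not be sigma-finite in general; here the measurable left inverse [split] of
   [consp] pulls an exhaustion back. *)
have pm_fin : sigma_finite setT pm.
  have [F FT Fmu] := sigma_finite_product mu m.
  pose split (t : n.+1.-tuple R) : measurableTypeR R * n.-tuple R :=
    (thead t, [tuple of behead t]).
  have splitK p : split (consp p) = p.
    by case: p => x t; congr pair; apply/val_inj.
  have msplit : measurable_fun setT split.
    apply/measurable_fun_pairP; split; first exact: measurable_tnth.
    exact: measurable_behead.
  exists (fun k => split @^-1` F k).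
    by rewrite -preimage_bigcup -FT preimage_setT.
  move=> k; have [mFk Fk] := Fmu k; split.
    by rewrite -[X in measurable X]setTI; exact: msplit.
  rewrite /pm /= /pushforward -comp_preimage.
  by rewrite (_ : split \o _ = id) ?preimage_id//; apply/funext => p; exact: splitK.
pose sm : {sigma_finite_measure set (n.+1.-tuple R) -> \bar R} :=
  HB.pack (pushforward (mu \x m)%E (@consp n)) (@Measure_isSigmaFinite.Build _ _ _ pm pm_fin).
exists (sm (@measurable_consp n)) => g mg g0.
transitivity (\int[pushforward (mu \x m)%E (@consp n)]_t g t)%E; last by [].
rewrite (ge0_integral_pushforward (@measurable_consp n))// preimage_setT.
have mgc : measurable_fun setT (g \o @consp n) by apply: (measurableT_comp mg); exact: measurable_consp.
rewrite fubini_tonelli1//=; apply: eq_integral => x _; rewrite mE//.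
exact: (measurableT_comp mgc (pair1_measurable x)).
Qed.

End lebesgue_tuple.

(** * Affine substitution and Gaussians in iterated integrals *)

Section intn_theory.
Context {R : realType}.
Local Notation mu := (@lebesgue_measure R).
Local Open Scope ereal_scope.

Lemma measurable_cons_tuple n (x : R) :
  measurable_fun setT (fun t : n.-tuple R => (cons_tuple x t : n.+1.-tuple R)).
Proof.
have := @measurable_cons _ _ (n.-tuple R) R (fun=> x) n id
  (@measurable_cst _ _ _ _ _ _) (@measurable_id _ _ _).
by congr measurable_fun; apply/funext => t; apply/val_inj.
Qed.

Lemma intn_ge0 n (g : n.-tuple R -> \bar R) : (forall t, 0 <= g t) -> 0 <= intn g.
Proof.
elim: n g => [|n IH] g g0 /=; first exact: g0.
by apply: integral_ge0 => x _; apply: IH => t.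
Qed.

Lemma measurable_intn n (g : n.+1.-tuple R -> \bar R) :
  measurable_fun setT g -> (forall t, 0 <= g t) ->
  measurable_fun setT (fun x : measurableTypeR R => intn (fun t => g (cons_tuple x t))).
Proof.
move=> mg g0; have [m mE] := @intn_integral R n.
have mc : measurable_fun setT
    (fun p : measurableTypeR R * n.-tuple R => (cons_tuple p.1 p.2 : n.+1.-tuple R)).
  have := @measurable_cons _ _ (measurableTypeR R * n.-tuple R)%type R fst n snd
    (@measurable_fst _ _ _ _) (@measurable_snd _ _ _ _).
  by congr measurable_fun; apply/funext => p; apply/val_inj.
have mgc : measurable_fun setT
    (fun p : measurableTypeR R * n.-tuple R => g (cons_tuple p.1 p.2)).
  exact: (measurableT_comp mg mc).
have := @measurable_fun_fubini_tonelli_F _ _ _ _ _ m _ mgc (fun _ => g0 _).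
congr measurable_fun; apply/funext => x; rewrite /fubini_F mE//.
exact: (measurableT_comp mgc (pair1_measurable x)).
Qed.

(** The translation is a sequence on [nat], so that removing the first coordinate in an induction on
    [n] is the shift [b k.+1]. *)
Definition afft n (a : R) (b : nat -> R) (t : n.-tuple R) : n.-tuple R :=
  [tuple (a * tnth t i + b i)%R | i < n].

Lemma measurable_afft n a b : measurable_fun setT (@afft n a b).
Proof.
apply/measurable_fun_tnthP => i.
rewrite (_ : _ \o _ = fun t => (a * tnth t i + b i)%R); last first.
  by apply/funext => t; rewrite /= tnth_mktuple.
by apply: measurable_funD => //; apply: measurable_funM => //; exact: measurable_tnth.
Qed.

Lemma afft_cons n a b (x : R) (t : n.-tuple R) :
  afft a b (cons_tuple x t) =
  cons_tuple (a * x + b 0%N)%R (afft a (fun k => b k.+1) t) :> n.+1.-tuple R.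
Proof.
apply: eq_from_tnth => i; rewrite tnth_mktuple.
case: (unliftP ord0 i) => [j|] -> /=; last by rewrite !tnth0.
by rewrite !tnthS tnth_mktuple.
Qed.

Lemma intn_affine n (a : R) (b : nat -> R) (g : n.-tuple R -> \bar R) :
  a != 0%R -> measurable_fun setT g -> (forall t, 0 <= g t) ->
  intn (fun t => g (afft a b t)) = ((`|a| ^- n)%:E * intn g).
Proof.
move=> a0; elim: n b g => [|n IH] b g mg g0.
  by rewrite expr0 invr1 mul1e /=; congr g; exact: tuple0.
have an : (0 <= (`|a| ^- n)%:E) by rewrite lee_fin invr_ge0 exprn_ge0.
rewrite [LHS]/=.
under eq_integral => x _.
  rewrite (_ : (fun t => _) = (fun t => g (cons_tuple (a * x + b 0%N)%R
      (afft a (fun k => b k.+1) t)))); last by apply/funext => t; rewrite -afft_cons.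
  rewrite (IH _ (fun t => g (cons_tuple (a * x + b 0%N)%R t)))//; last first.
    apply: (measurableT_comp mg); exact: measurable_cons_tuple.
  over.
have mi := measurable_intn mg g0.
have i0 x : 0 <= intn (fun t => g (cons_tuple x t)) by exact: intn_ge0.
rewrite ge0_integralZl//; last first.
  by apply: (measurableT_comp mi); exact: measurable_affine.
have -> := @ge0_integral_affine R a (b 0%N) _ a0 mi i0.
by rewrite muleA -EFinM exprSr invfM.
Qed.

Lemma intn_gaussian n (c : R) : (0 < c)%R ->
  intn (fun t : n.-tuple R => (expR (- (c * \sum_i (tnth t i) ^+ 2)))%:E) < +oo.
Proof.
move=> c0; elim: n => [|n IH]; first by rewrite /= ltry.
pose I := intn (fun t : n.-tuple R => (expR (- (c * \sum_i (tnth t i) ^+ 2)))%:E).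
have I0 : 0 <= I by apply: intn_ge0 => t; rewrite lee_fin expR_ge0.
have [m mE] := @intn_integral R n.
have mg : measurable_fun setT (fun t : n.-tuple R => (expR (- (c * \sum_i (tnth t i) ^+ 2)))%:E).
  apply/measurable_EFinP; apply: measurableT_comp => //; apply: measurableT_comp => //.
  apply: measurable_funM => //; apply: measurable_sum => i.
  by apply: measurable_funX; exact: measurable_tnth.
have E (x : R) : intn (fun t => (expR (- (c *
    \sum_(i < n.+1) tnth (cons_tuple x t) i ^+ 2)))%:E) =
    (expR (- (c * x ^+ 2)))%:E * I.
  rewrite (_ : (fun t => _) = (fun t => (expR (- (c * x ^+ 2)))%:E *
      (expR (- (c * \sum_i (tnth t i) ^+ 2)))%:E)); last first.
    apply/funext => t; rewrite -EFinM -expRD big_ord_recl tnth0.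
    under eq_bigr do rewrite tnthS.
    by rewrite mulrDr opprD.
  rewrite mE; last by move=> t; rewrite mule_ge0.
    by rewrite ge0_integralZl// /I mE.
  by apply: emeasurable_funM => //; exact: measurable_cst.
rewrite /=; under eq_integral do rewrite E.
have iG := @integrable_gaussian R c c0.
have Goo := integrable_lty measurableT iG.
rewrite ge0_integralZr//; last exact: measurable_int iG.
rewrite lte_mul_pinfty//; last by rewrite ge0_fin_numE// integral_ge0.
by rewrite integral_ge0.
Qed.

End intn_theory.

(** * Quadratic forms and symplectic matrices *)

Section quadratic_forms.
Context {R : realType}.

Lemma dotvE n (x y : 'cV[R]_n) : dotv x y = (x^T *m y) 0 0.
Proof. by rewrite mxE; apply: eq_bigr => i _; rewrite mxE. Qed.

Lemma dotvC n (x y : 'cV[R]_n) : dotv x y = dotv y x.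
Proof. by apply: eq_bigr => i _; rewrite mulrC. Qed.

Lemma dotvDr n (x y z : 'cV[R]_n) : dotv x (y + z) = dotv x y + dotv x z.
Proof. by rewrite -big_split; apply: eq_bigr => i _; rewrite mxE mulrDr. Qed.

Lemma dotvZr n k (x y : 'cV[R]_n) : dotv x (k *: y) = k * dotv x y.
Proof. by rewrite mulr_sumr; apply: eq_bigr => i _; rewrite mxE mulrCA. Qed.

Lemma dotvDl n (x y z : 'cV[R]_n) : dotv (x + y) z = dotv x z + dotv y z.
Proof. by rewrite !(dotvC _ z) dotvDr. Qed.

Lemma dotvZl n k (x y : 'cV[R]_n) : dotv (k *: x) y = k * dotv x y.
Proof. by rewrite !(dotvC _ y) dotvZr. Qed.

Lemma dotv_mulmx n p (M : 'M[R]_(n, p)) (x : 'cV[R]_n) (y : 'cV[R]_p) :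
  dotv x (M *m y) = dotv (M^T *m x) y.
Proof. by rewrite !dotvE trmx_mul trmxK mulmxA. Qed.

Lemma qfE n (M : 'M[R]_n) x : qf M x = dotv x (M *m x).
Proof. by rewrite /qf dotvE mulmxA. Qed.

Lemma dotv_ge0 n (x : 'cV[R]_n) : 0 <= dotv x x.
Proof. by apply: sumr_ge0 => i _; rewrite -expr2 sqr_ge0. Qed.

Lemma dotv_eq0 n (x : 'cV[R]_n) : dotv x x = 0 -> x = 0.
Proof.
move=> /eqP; rewrite psumr_eq0 => [/allP x0|i _]; last by rewrite -expr2 sqr_ge0.
apply/colP => i; rewrite mxE; have := x0 i; rewrite mem_index_enum => /(_ isT)/=.
by rewrite mulf_eq0 orbb => /eqP.
Qed.

Section psd.
Variables (n : nat) (M : 'M[R]_n).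
Hypothesis Mpsd : sym_psd M.

Let sym x y : dotv x (M *m y) = dotv y (M *m x).
Proof. by rewrite dotv_mulmx Mpsd.1 dotvC. Qed.

Lemma qf_lincomb (s t : R) x y : qf M (s *: x + t *: y) =
  s ^+ 2 * qf M x + 2 * s * t * dotv x (M *m y) + t ^+ 2 * qf M y.
Proof.
rewrite !qfE mulmxDr -!scalemxAr !(dotvDl, dotvDr, dotvZl, dotvZr) (sym y x); ring.
Qed.

Lemma qf_cauchy_schwarz x y : (dotv x (M *m y)) ^+ 2 <= qf M x * qf M y.
Proof.
set b := dotv x (M *m y).
have P0 := Mpsd.2 x; have Q0 := Mpsd.2 y.
have [Px|Px] := eqVneq (qf M x) 0.
  suff -> : b = 0 by rewrite expr0n mulr_ge0.
  apply/eqP; apply/negPn/negP => b0.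
  (* If [qf M x = 0] and [b] is nonzero, the form is affine in the coefficient of [x]; this
     coefficient gives it the value -1. *)
  have := Mpsd.2 ((- (qf M y + 1) / (2 * b)) *: x + 1 *: y).
  rewrite qf_lincomb Px -/b leNgt => /negP; apply.
  have -> : (- (qf M y + 1) / (2 * b)) ^+ 2 * 0 + 2 * (- (qf M y + 1) / (2 * b)) * 1 * b +
    1 ^+ 2 * qf M y = -1 by field.
  by rewrite ltrN10.
have Px0 : 0 < qf M x by rewrite lt_def Px.
rewrite -(ler_pM2l Px0) -subr_ge0.
(* At this vector the form equals [qf M x * (qf M x * qf M y - b^2)]. *)
have := Mpsd.2 ((- b) *: x + qf M x *: y); rewrite qf_lincomb -/b.
by congr (0 <= _); ring.
Qed.

(** Cauchy-Schwarz for the form, applied to the vectors [M x] and [x]. *)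
Lemma qf_eq0 x : qf M x = 0 -> M *m x = 0.
Proof.
move=> q0; apply: dotv_eq0; apply/eqP; rewrite -sqrf_eq0 eq_le sqr_ge0 andbT.
by rewrite (le_trans (qf_cauchy_schwarz _ _))// q0 mulr0.
Qed.

End psd.

Lemma sym_psd1 n : sym_psd (1%:M : 'M[R]_n).
Proof. by split => [|x]; rewrite ?trmx1// qfE mul1mx dotv_ge0. Qed.

Lemma dotv_cauchy_schwarz n (x y : 'cV[R]_n) :
  (dotv x y) ^+ 2 <= dotv x x * dotv y y.
Proof. by have := qf_cauchy_schwarz (sym_psd1 n) x y; rewrite !qfE !mul1mx. Qed.

(** Joint injectivity gives the stacked matrix a left inverse [U], hence
    [|x|^2 <= T (|M x|^2 + |K x|^2)] with [T] the squared Frobenius norm of [U]. Cauchy-Schwarz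
    against the basis vectors gives [|M x|^2 <= tM * qf M x], where [tM] is the trace of [M]. *)
Lemma psd_coercive n k (M : 'M[R]_n) (K : 'M[R]_(k, n)) : sym_psd M ->
  (forall x : 'cV_n, M *m x = 0 -> K *m x = 0 -> x = 0) ->
  exists2 c, 0 < c &
    forall x, c * dotv x x <= qf M x + dotv (K *m x) (K *m x).
Proof.
move=> Mpsd inj.
have : row_full (col_mx M K).
  rewrite /row_full -mxrank_tr -/(row_free _); apply: inj_row_free => v.
  move/(congr1 trmx); rewrite trmx_mul trmxK trmx0 mul_col_mx -[0]vsubmxK.
  rewrite !linear0 => /eq_col_mx[Mv Kv].
  by apply: trmx_inj; rewrite trmx0; exact: inj.
move=> /row_fullP[U UL].
pose T := \sum_i dotv (row i U)^T (row i U)^T.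
have T0 : 0 <= T by apply: sumr_ge0 => i _; exact: dotv_ge0.
pose tM := \sum_i qf M (delta_mx i 0).
have tM0 : 0 <= tM by apply: sumr_ge0 => i _; exact: Mpsd.2.
have bound x : dotv x x <= T * (tM * qf M x + dotv (K *m x) (K *m x)).
  have E : dotv (col_mx M K *m x) (col_mx M K *m x) =
      dotv (M *m x) (M *m x) + dotv (K *m x) (K *m x).
    rewrite /dotv mul_col_mx big_split_ord/=; congr (_ + _); apply: eq_bigr => i _.
      by rewrite col_mxEu.
    by rewrite col_mxEd.
  apply: (@le_trans _ _ (T * dotv (col_mx M K *m x) (col_mx M K *m x))).
    rewrite /T mulr_suml /dotv; apply: ler_sum => i _.
    apply: le_trans (dotv_cauchy_schwarz _ _); rewrite -expr2.
    have -> // : dotv (row i U)^T (col_mx M K *m x) = x i 0.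
    by rewrite dotvE trmxK -row_mul mulmxA UL mul1mx mxE.
  rewrite E ler_wpM2l// lerD2r /tM mulr_suml /dotv; apply: ler_sum => i _.
  rewrite -expr2; apply: le_trans (qf_cauchy_schwarz Mpsd _ _).
  have -> // : dotv (delta_mx i 0) (M *m x) = (M *m x) i 0.
  by rewrite dotvE trmx_delta -rowE mxE.
(* The final [+ 1] keeps the denominator positive even when [T = 0]. *)
exists (T * (tM + 1) + 1)^-1; first by rewrite invr_gt0 ltr_wpDl// mulr_ge0// addr_ge0.
move=> x; have Q0 := Mpsd.2 x; have S0 := dotv_ge0 (K *m x).
rewrite mulrC ler_pdivrMr; last by rewrite ltr_wpDl// mulr_ge0// addr_ge0.
apply: le_trans (bound x) _.
rewrite -subr_ge0.
have -> : (qf M x + dotv (K *m x) (K *m x)) * (T * (tM + 1) + 1) -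
  T * (tM * qf M x + dotv (K *m x) (K *m x)) =
  T * qf M x + T * tM * dotv (K *m x) (K *m x) + (qf M x + dotv (K *m x) (K *m x)) by ring.
by rewrite !addr_ge0// !mulr_ge0.
Qed.

End quadratic_forms.

(** * Block identities of a symplectic matrix *)

Section symplectic_blocks.
Context {R : realType} {n : nat}.
Variables A B C D : 'M[R]_n.
Hypothesis sympS : symplectic (block_mx A B C D).
Let S := block_mx A B C D.

Lemma Jmx_sqr : Jmx R n *m Jmx R n = - 1%:M.
Proof.
rewrite /Jmx mulmx_block !mulmx0 !mul0mx !add0r !addr0 mulmxN mulNmx !mul1mx.
by rewrite (scalar_mx_block n n 1) opp_block_mx !oppr0.
Qed.

Lemma symplectic_inv : (- (Jmx R n *m S^T *m Jmx R n)) *m S = 1%:M.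
Proof.
by rewrite mulNmx -(mulmxA (Jmx R n) S^T) -mulmxA sympS Jmx_sqr opprK.
Qed.

Lemma symplectic_unit : S \in unitmx.
Proof. by have [] := mulmx1_unit symplectic_inv. Qed.

(** The left inverse [- J S^T J] of [S] is also a right inverse. *)
Lemma symplectic_tr : S *m Jmx R n *m S^T = Jmx R n.
Proof.
have := mulmx1C symplectic_inv; rewrite mulmxN !mulmxA => /(congr1 (fun X => - (X *m Jmx R n))).
by rewrite mulNmx opprK -(mulmxA _ (Jmx R n) (Jmx R n)) Jmx_sqr mulmxN mulmx1 mul1mx => /oppr_inj.
Qed.

Lemma symplectic_blocks : A *m B^T = B *m A^T /\ D *m A^T - C *m B^T = 1%:M.
Proof.
have := symplectic_tr; rewrite /S /Jmx tr_block_mx !mulmx_block.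
rewrite !mulmx0 !mulmx1 !mulmxN !mulmx1 !addr0 !add0r => /eq_block_mx[ul _ dl _].
split; first by apply/eqP; rewrite -subr_eq0 addrC -mulNmx ul.
by apply: oppr_inj; rewrite -dl opprB mulNmx addrC.
Qed.

Lemma symplectic_col (v : 'cV[R]_n) : S *m col_mx 0 v = col_mx (B *m v) (D *m v).
Proof. by rewrite mul_block_col !mulmx0 !add0r. Qed.

(* [s = D A^T s] and [A^T s] lies in [ker B], on which [D^T s] vanishes. *)
Lemma symplectic_ker_inj (s : 'cV[R]_n) : B^T *m s = 0 ->
  (forall p, B *m p = 0 -> dotv p (D^T *m s) = 0) -> s = 0.
Proof.
move=> Bs Ds; have [AB DA] := symplectic_blocks.
have E : s = D *m (A^T *m s).
  by rewrite -{1}[s]mul1mx -DA mulmxBl -!mulmxA Bs mulmx0 subr0.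
apply: dotv_eq0; rewrite {2}E dotv_mulmx dotvC.
by apply: Ds; rewrite mulmxA -AB -mulmxA Bs mulmx0.
Qed.

End symplectic_blocks.

Section critical_direction.
Context {R : realType} {n : nat}.
Variables B M N : 'M[R]_n.
Hypotheses (Mpsd : sym_psd M) (Npsd : sym_psd N).

(** [eigenvalue] concerns row vectors; transposing gives [B^T N B M b = lambda b], and pairing with
    [M b] gives the second claim. If [qf M b] were 0, then [M b = 0] and [lambda b = 0]. *)
Lemma eigenvalue_direction (lambda : R) : 0 < lambda ->
  eigenvalue (M *m B^T *m N *m B) lambda ->
  exists2 b, 0 < qf M b & qf N (B *m (M *m b)) = lambda * qf M b.
Proof.
move=> l0 /eigenvalueP[v vE v0].
have {}vE : B^T *m (N *m (B *m (M *m v^T))) = lambda *: v^T.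
  move/(congr1 trmx): vE; rewrite linearZ/= => <-.
  by rewrite !trmx_mul Mpsd.1 Npsd.1 trmxK !mulmxA.
exists v^T.
  rewrite lt_def Mpsd.2 andbT; apply: contra v0 => /eqP/(qf_eq0 Mpsd) Mv.
  move: vE; rewrite Mv !mulmx0 => /esym/eqP; rewrite scaler_eq0 gt_eqF//=.
  by rewrite trmx_eq0.
by rewrite !qfE (dotvC v^T) -dotvZr -vE [RHS]dotv_mulmx trmxK.
Qed.

End critical_direction.

(** * Gaussian smoothing along the kernel of B *)

Section gaussian_smoothing.
Context {R : realType} {d : measure_display} {T : measurableType d}.
Variable m : {sigma_finite_measure set T -> \bar R}.
Local Notation mu := (@lebesgue_measure R).

Lemma trig_le2 (p q th : R) : `|p * cos th + q * sin th| <= `|p| + `|q|.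
Proof.
rewrite (le_trans (ler_normD _ _))// !normrM lerD// ler_piMr//.
  exact: cos_max.
exact: sin_max.
Qed.

Let A0 : 0 < 4^-1 :> R. Proof. by rewrite invr_gt0. Qed.

(** The constant 1/4 is chosen so that averaging over the phase [k c] yields exactly the factor
    [exp (- c^2)]. The part odd in [k] integrates to zero. *)
Lemma gaussian_trig (p q th c : R) :
  \int[mu]_k (expR (- (4^-1 * k ^+ 2)) * (p * cos (th + k * c) + q * sin (th + k * c))) =
  \int[mu]_k expR (- (4^-1 * k ^+ 2)) * (expR (- c ^+ 2) * (p * cos th + q * sin th)).
Proof.
pose g (k : R) := expR (- (4^-1 * k ^+ 2)).
have ig (h : R -> R) : measurable_fun setT h -> (forall x, `|h x| <= 1) ->
    mu.-integrable setT (EFin \o (fun x => g x * h x)).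
  move=> mh h1; apply: dominated_Rintegrable (integrable_gaussian A0).
    apply: measurable_funM => //.
    by apply: measurableT_comp => //; apply: measurableT_comp => //; exact: measurable_funM.
  by move=> x; rewrite normrM ger0_norm ?expR_ge0// ler_piMr ?expR_ge0.
have ic : mu.-integrable setT (EFin \o (fun k => g k * cos (c * k))).
  apply: ig => [|x]; last exact: cos_max.
  by apply: (measurableT_comp (@measurable_cos R)); exact: measurable_funM.
have is_ : mu.-integrable setT (EFin \o (fun k => g k * sin (c * k))).
  apply: ig => [|x]; last exact: sin_max.
  by apply: (measurableT_comp (@measurable_sin R)); exact: measurable_funM.
have E k : expR (- (4^-1 * k ^+ 2)) * (p * cos (th + k * c) + q * sin (th + k * c)) =
    (p * cos th + q * sin th) * (g k * cos (c * k)) +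
    (q * cos th - p * sin th) * (g k * sin (c * k)).
  by rewrite cosD sinD (mulrC k) /g; ring.
under eq_Rintegral do rewrite E.
rewrite RintegralD//; last 2 first.
- exact: (@integrableZl _ _ _ _ _ measurableT (p * cos th + q * sin th) _ ic).
- exact: (@integrableZl _ _ _ _ _ measurableT (q * cos th - p * sin th) _ is_).
rewrite !RintegralZl// Rintegral_gaussian_sin// mulr0 addr0 gaussian_fourier//.
have -> : c ^+ 2 / (4 * 4^-1) = c ^+ 2 by rewrite mulfV ?divr1// pnatr_eq0.
ring.
Qed.

Variables (P Q th c : T -> R).
Hypotheses (mth : measurable_fun setT th) (mc : measurable_fun setT c).
Hypotheses (iP : m.-integrable setT (EFin \o P)) (iQ : m.-integrable setT (EFin \o Q)).

(** Fubini, with [|P| + |Q|] times the Gaussian as bound, then [gaussian_trig] pointwise: averaging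
    over modulations along [c] is multiplication by a Gaussian in [c]. *)
Lemma gaussian_smoothing :
  \int[mu]_k (expR (- (4^-1 * k ^+ 2)) *
    \int[m]_x (P x * cos (th x + k * c x) + Q x * sin (th x + k * c x))) =
  \int[mu]_k expR (- (4^-1 * k ^+ 2)) *
    \int[m]_x (expR (- c x ^+ 2) * (P x * cos (th x) + Q x * sin (th x))).
Proof.
have mP : measurable_fun setT P by apply/measurable_EFinP; exact: measurable_int iP.
have mQ : measurable_fun setT Q by apply/measurable_EFinP; exact: measurable_int iQ.
have mcos := @measurable_cos R; have msin := @measurable_sin R.
have iPQ : m.-integrable setT (EFin \o (fun x => `|P x| + `|Q x|)).
  exact: (integrableD measurableT (integrable_norm iP) (integrable_norm iQ)).
pose f (z : T * measurableTypeR R) : R := expR (- (4^-1 * z.2 ^+ 2)) *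
  (P z.1 * cos (th z.1 + z.2 * c z.1) + Q z.1 * sin (th z.1 + z.2 * c z.1)).
have mf : measurable_fun setT f.
  have m1 (g : T -> R) : measurable_fun setT g ->
      measurable_fun setT (fun z : T * measurableTypeR R => g z.1).
    by move=> mg; exact: (measurableT_comp mg).
  have mg : measurable_fun setT (fun k : measurableTypeR R => expR (- (4^-1 * k ^+ 2)) : R).
    by apply: measurableT_comp => //; apply: measurableT_comp => //; exact: measurable_funM.
  have marg : measurable_fun setT (fun z : T * measurableTypeR R => th z.1 + z.2 * c z.1).
    apply: measurable_funD; first exact: m1.
    by apply: measurable_funM; [exact: measurable_snd|exact: m1].
  apply: measurable_funM; first exact: (measurableT_comp mg).
  apply: measurable_funD; apply: measurable_funM; try exact: m1.
    exact: (measurableT_comp mcos).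
  exact: (measurableT_comp msin).
have := Rintegral_Fubini_dominated mf iPQ (integrable_gaussian A0).
move=> /(_ _)/esym FB.
transitivity (\int[mu]_k \int[m]_x f (x, k)).
  apply: eq_Rintegral => k _; rewrite -RintegralZl//.
  apply: dominated_Rintegrable iPQ; last by move=> x; exact: trig_le2.
  have marg : measurable_fun setT (fun x => th x + k * c x).
    by apply: measurable_funD => //; exact: measurable_funM.
  by apply: measurable_funD; apply: measurable_funM => //; exact: measurableT_comp.
rewrite FB; last first.
  move=> x k; rewrite normrM (ger0_norm (expR_ge0 _)) mulrC.
  by rewrite ler_wpM2r ?expR_ge0// trig_le2.
rewrite -RintegralZl//; last first.
  apply: dominated_Rintegrable iPQ.
    apply: measurable_funM.
      by apply: measurableT_comp => //; apply: measurableT_comp => //; exact: measurable_funX.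
    by apply: measurable_funD; apply: measurable_funM => //; exact: measurableT_comp.
  move=> x; rewrite normrM (ger0_norm (expR_ge0 _)).
  apply: le_trans (trig_le2 _ _ (th x)); rewrite ler_piMl//.
  by rewrite -expR0 ler_expR oppr_le0 sqr_ge0.
by apply: eq_Rintegral => x _; rewrite /f/= gaussian_trig.
Qed.

End gaussian_smoothing.

Lemma Rintegral_gaussian_gt0 (R : realType) (A : R) : 0 < A ->
  0 < \int[@lebesgue_measure R]_k expR (- (A * k ^+ 2)).
Proof.
move=> A0; have sA : 0 < Num.sqrt A by rewrite sqrtr_gt0.
have ig : (@lebesgue_measure R).-integrable setT (EFin \o (@gauss_fun R)).
  have := @integrable_gaussian R 1 ltr01; apply: eq_integrable => // x _ /=.
  by rewrite mul1r.
have := Rintegral_affine 0 (lt0r_neq0 sA) ig.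
under eq_Rintegral do rewrite addr0 /gauss_fun exprMn sqr_sqrtr ?ltW//.
move=> ->; rewrite mulr_gt0 ?invr_gt0 ?normr_gt0 ?gt_eqF//.
by rewrite /Rintegral integralT_gauss sqrtr_gt0 pi_gt0.
Qed.

(** * Gaussian weights in the covariance identity *)

Section kernel_weights.
Context {R : realType} {n : nat}.
Variable m : {sigma_finite_measure set (n.-tuple R) -> \bar R}.
Variables B D : 'M[R]_n.
Variables (phi : n.-tuple R -> R) (X Y : 'cV[R]_n -> n.-tuple R -> R).
Local Notation mu := (@lebesgue_measure R).

(** One Gaussian factor per vector of [ps], in the normalisation that [gaussian_smoothing] produces
    from the phase [2 * pi * dotv p x]. *)
Definition weight (ps : seq 'cV[R]_n) (x : 'cV[R]_n) : R :=
  expR (- \sum_(p <- ps) (2 * pi * dotv p x) ^+ 2).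

Lemma measurable_dotv (v : 'cV[R]_n) :
  measurable_fun setT (fun t : n.-tuple R => dotv v (colv t)).
Proof.
apply: measurable_sum => i; apply: measurable_funM => //.
rewrite (_ : (fun _ => _) = (fun t : n.-tuple R => tnth t i)); last first.
  by apply/funext => t; rewrite mxE.
exact: measurable_tnth.
Qed.

Lemma measurable_weight ps : measurable_fun setT (fun t : n.-tuple R => weight ps (colv t)).
Proof.
apply: measurableT_comp => //; apply: measurableT_comp => //.
apply: measurable_sum => p; apply: measurable_funX; apply: measurable_funM => //.
exact: measurable_dotv.
Qed.

Lemma weight_le1 ps x : 0 <= weight ps x <= 1.
Proof.
rewrite expR_ge0/= -expR0 ler_expR oppr_le0; apply: sumr_ge0 => p _; exact: sqr_ge0.
Qed.

Lemma weight_cons p ps x :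
  weight (p :: ps) x = expR (- (2 * pi * dotv p x) ^+ 2) * weight ps x.
Proof. by rewrite /weight big_cons opprD expRD. Qed.

Hypothesis iphi : m.-integrable setT (EFin \o phi).
Hypothesis iX : forall u, m.-integrable setT (EFin \o X u).
Hypothesis iY : forall u, m.-integrable setT (EFin \o Y u).

Let iweight ps (f : n.-tuple R -> R) : m.-integrable setT (EFin \o f) ->
  m.-integrable setT (EFin \o (fun t => weight ps (colv t) * f t)).
Proof.
move=> fi; apply: dominated_Rintegrable (integrable_norm fi).
  apply: measurable_funM; first exact: measurable_weight.
  by apply/measurable_EFinP; exact: measurable_int fi.
move=> t; rewrite normrM; have /andP[w0 w1] := weight_le1 ps (colv t).
by rewrite (ger0_norm w0) ler_piMl.
Qed.

Hypothesis covariance : forall v,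
  \int[m]_t (phi t * cos (2 * pi * dotv v (colv t))) =
  \int[m]_t (X (B *m v) t * cos (2 * pi * dotv (D *m v) (colv t)) +
             Y (B *m v) t * sin (2 * pi * dotv (D *m v) (colv t))).

(* Translating [v] along [p] in [ker B] only modulates both sides, so a Gaussian
   average over [v + k p] multiplies each side by a Gaussian weight. *)
Lemma weighted_covariance ps v : {in ps, forall p, B *m p = 0} ->
  \int[m]_t (weight ps (colv t) * phi t * cos (2 * pi * dotv v (colv t))) =
  \int[m]_t (weight [seq D *m p | p <- ps] (colv t) *
            (X (B *m v) t * cos (2 * pi * dotv (D *m v) (colv t)) +
             Y (B *m v) t * sin (2 * pi * dotv (D *m v) (colv t)))).
Proof.
elim: ps v => [|p ps IH] v psB.
  rewrite /weight; under eq_Rintegral do rewrite big_nil oppr0 expR0 mul1r.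
  by under [RHS]eq_Rintegral do rewrite big_nil oppr0 expR0 mul1r.
have Bp : B *m p = 0 by apply: psB; rewrite mem_head.
have {}psB : {in ps, forall p, B *m p = 0}.
  by move=> q qps; apply: psB; rewrite in_cons qps orbT.
have A0 : 0 < 4^-1 :> R by rewrite invr_gt0.
(* Both sides are multiplied by the positive mass of the Gaussian, the factor that appears in
   [gaussian_smoothing]. *)
apply: (mulfI (lt0r_neq0 (Rintegral_gaussian_gt0 A0))).
have mdot u : measurable_fun setT (fun t : n.-tuple R => 2 * pi * dotv u (colv t)).
  by apply: measurable_funM => //; exact: measurable_dotv.
have i0 : m.-integrable setT (EFin \o (fun _ : n.-tuple R => 0 : R)) by exact: integrable0.
have EL := gaussian_smoothing (mdot v) (mdot p) (iweight ps iphi) i0.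
have ER := gaussian_smoothing (mdot (D *m v)) (mdot (D *m p))
  (iweight [seq D *m q | q <- ps] (iX (B *m v))) (iweight [seq D *m q | q <- ps] (iY (B *m v))).
transitivity (\int[mu]_k (expR (- (4^-1 * k ^+ 2)) *
    \int[m]_t (weight ps (colv t) * phi t * cos (2 * pi * dotv (v + k *: p) (colv t))))).
  transitivity (\int[mu]_k expR (- (4^-1 * k ^+ 2)) *
     \int[m]_t (expR (- (2 * pi * dotv p (colv t)) ^+ 2) *
       (weight ps (colv t) * phi t * cos (2 * pi * dotv v (colv t)) +
        0 * sin (2 * pi * dotv v (colv t))))).
    congr (_ * _); apply: eq_Rintegral => t _.
    by rewrite weight_cons mul0r addr0 !mulrA.
  rewrite -EL; apply: eq_Rintegral => k _; congr (_ * _); apply: eq_Rintegral => t _.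
  by rewrite mul0r addr0 dotvDl dotvZl; congr (_ * cos _); ring.
transitivity (\int[mu]_k (expR (- (4^-1 * k ^+ 2)) *
    \int[m]_t (weight [seq D *m q | q <- ps] (colv t) * X (B *m v) t *
         cos (2 * pi * dotv (D *m v) (colv t) + k * (2 * pi * dotv (D *m p) (colv t))) +
       weight [seq D *m q | q <- ps] (colv t) * Y (B *m v) t *
         sin (2 * pi * dotv (D *m v) (colv t) + k * (2 * pi * dotv (D *m p) (colv t)))))).
  apply: eq_Rintegral => k _; congr (_ * _); rewrite IH//.
  rewrite !mulmxDr -!scalemxAr Bp scaler0 addr0.
  apply: eq_Rintegral => t _.
  have -> : 2 * pi * dotv (D *m v + k *: (D *m p)) (colv t) =
      2 * pi * dotv (D *m v) (colv t) + k * (2 * pi * dotv (D *m p) (colv t)).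
    by rewrite dotvDl dotvZl; ring.
  ring.
rewrite ER; congr (_ * _); apply: eq_Rintegral => t _.
by rewrite /= weight_cons; ring.
Qed.

End kernel_weights.

(** * Square-integrable functions and the Wigner distribution *)

Section complex_plane.
Context {R : realType}.
Implicit Types z w : R[i].
Local Notation Re := (@complex.Re R).
Local Notation Im := (@complex.Im R).
Local Notation normc := (@Normc.normc R).

Lemma normc_sqr z : normc z ^+ 2 = Re z ^+ 2 + Im z ^+ 2.
Proof. by case: z => a b /=; rewrite sqr_sqrtr// addr_ge0// sqr_ge0. Qed.

Lemma normc_nneg z : 0 <= normc z. Proof. by case: z => a b /=; exact: sqrtr_ge0. Qed.

Lemma normc_sqr_eq0 z : normc z ^+ 2 = 0 -> z = 0.
Proof.
rewrite normc_sqr; case: z => a b /= /eqP.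
by rewrite paddr_eq0 ?sqr_ge0// !sqrf_eq0 => /andP[/eqP -> /eqP ->].
Qed.

(** [dotc] and [crossc] are the real and imaginary parts of [z] times the conjugate of [w]. *)
Definition dotc z w : R := Re z * Re w + Im z * Im w.
Definition crossc z w : R := Im z * Re w - Re z * Im w.

Lemma dotc_crossc z w : dotc z w ^+ 2 + crossc z w ^+ 2 = (normc z * normc w) ^+ 2.
Proof. by rewrite exprMn !normc_sqr /dotc /crossc; ring. Qed.

Lemma dotc_le z w : `|dotc z w| <= normc z * normc w.
Proof.
rewrite -ler_sqr ?nnegrE ?mulr_ge0 ?normc_nneg// -dotc_crossc real_normK ?num_real//.
by rewrite lerDl sqr_ge0.
Qed.

Lemma crossc_le z w : `|crossc z w| <= normc z * normc w.
Proof.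
rewrite -ler_sqr ?nnegrE ?mulr_ge0 ?normc_nneg// -dotc_crossc real_normK ?num_real//.
by rewrite lerDr sqr_ge0.
Qed.

Lemma normcM_le z w : normc z * normc w <= normc z ^+ 2 + normc w ^+ 2.
Proof. by have := sqr_ge0 (normc z - normc w); have := normc_nneg z; have := normc_nneg w; nra. Qed.

Lemma dotcxx z : dotc z z = normc z ^+ 2.
Proof. by rewrite normc_sqr /dotc !expr2. Qed.

Lemma crosscxx z : crossc z z = 0.
Proof. by rewrite /crossc mulrC subrr. Qed.

Lemma normc_sub_sqr z w : normc (z - w) ^+ 2 = normc z ^+ 2 + normc w ^+ 2 - 2 * dotc z w.
Proof. by rewrite !normc_sqr /dotc; case: z => a b; case: w => c e /=; ring. Qed.

Lemma Re_conj_expi z w (th : R) :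
  Re (z * conjc w * expi (- th)) = dotc z w * cos th + crossc z w * sin th.
Proof.
by rewrite /expi cosN sinN /dotc /crossc; case: z => a b; case: w => c e /=; ring.
Qed.

End complex_plane.

(** * Square-integrable functions under affine maps, and the Wigner integral *)

Section square_integrable.
Context {R : realType} {n : nat}.
Implicit Types (f g : 'cV[R]_n -> R[i]) (b u x : 'cV[R]_n).
Local Notation Re := (@complex.Re R).
Local Notation Im := (@complex.Im R).
Local Notation normc := (@Normc.normc R).

(** A column extended by zero to a sequence, as [afft] expects. *)
Definition coords b (k : nat) : R := if insub k is Some i then b i 0 else 0.

Lemma colv_afft (a : R) b (t : n.-tuple R) : colv (afft a (coords b) t) = a *: colv t + b.
Proof.
apply/colP => i; rewrite !mxE tnth_mktuple /coords.
by rewrite (valK i).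
Qed.

Definition measurable_field f : Prop :=
  measurable_fun setT (fun t : n.-tuple R => Re (f (colv t))) /\
  measurable_fun setT (fun t : n.-tuple R => Im (f (colv t))).

Lemma L2_measurable f : L2 f -> measurable_field f.
Proof. by case. Qed.

Lemma measurable_normc_sqr f : measurable_field f ->
  measurable_fun setT (fun t : n.-tuple R => normc (f (colv t)) ^+ 2).
Proof.
move=> [mr mi]; under eq_fun do rewrite normc_sqr.
by apply: measurable_funD; exact: measurable_funX.
Qed.

Lemma measurable_field_affine (a : R) b f : measurable_field f ->
  measurable_field (fun x => f (a *: x + b)).
Proof.
move=> [mr mi]; split; under eq_fun do rewrite -colv_afft.
  exact: (measurableT_comp mr (measurable_afft _ _)).
exact: (measurableT_comp mi (measurable_afft _ _)).
Qed.

Lemma L2norm2_affine (a : R) b f : a != 0 -> measurable_field f ->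
  L2norm2 (fun x => f (a *: x + b)) = ((`|a| ^- n)%:E * L2norm2 f)%E.
Proof.
move=> a0 mf; rewrite /L2norm2 /intv.
under eq_fun do rewrite -colv_afft.
apply: (intn_affine (coords b) (g := fun t => (normc (f (colv t)) ^+ 2)%:E)) => //.
  by apply/measurable_EFinP; exact: measurable_normc_sqr.
by move=> t; rewrite lee_fin sqr_ge0.
Qed.

Lemma L2_affine (a : R) b f : a != 0 -> L2 f -> L2 (fun x => f (a *: x + b)).
Proof.
move=> a0 Lf; have mf := L2_measurable Lf.
have [mr mi] := measurable_field_affine a b mf.
split => //; rewrite -/(L2norm2 _) L2norm2_affine//.
by rewrite lte_mul_pinfty//; case: Lf.
Qed.

Variable m : {sigma_finite_measure set (n.-tuple R) -> \bar R}.
Hypothesis mE : forall g : n.-tuple R -> \bar R, measurable_fun setT g ->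
  (forall t, 0 <= g t)%E -> intn g = (\int[m]_t g t)%E.

Lemma L2norm2E f : measurable_field f ->
  L2norm2 f = (\int[m]_t (normc (f (colv t)) ^+ 2)%:E)%E.
Proof.
move=> mf; rewrite /L2norm2 /intv mE// => [|t]; last by rewrite lee_fin sqr_ge0.
by apply/measurable_EFinP; exact: measurable_normc_sqr.
Qed.

Lemma L2_integrable f : L2 f ->
  m.-integrable setT (EFin \o (fun t => normc (f (colv t)) ^+ 2)).
Proof.
move=> Lf; have mf := L2_measurable Lf; apply/integrableP; split.
  by apply/measurable_EFinP; exact: measurable_normc_sqr.
under eq_integral do rewrite /= ger0_norm ?sqr_ge0//.
by rewrite -L2norm2E//; case: Lf.
Qed.

Lemma integrable_dotc f g : L2 f -> L2 g ->
  m.-integrable setT (EFin \o (fun t => dotc (f (colv t)) (g (colv t)))).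
Proof.
move=> Lf Lg; have [fr fi] := L2_measurable Lf; have [gr gi] := L2_measurable Lg.
apply: dominated_Rintegrable (integrableD measurableT (L2_integrable Lf) (L2_integrable Lg)).
  by apply: measurable_funD; exact: measurable_funM.
by move=> t; apply: le_trans (dotc_le _ _) (normcM_le _ _).
Qed.

Lemma integrable_crossc f g : L2 f -> L2 g ->
  m.-integrable setT (EFin \o (fun t => crossc (f (colv t)) (g (colv t)))).
Proof.
move=> Lf Lg; have [fr fi] := L2_measurable Lf; have [gr gi] := L2_measurable Lg.
apply: dominated_Rintegrable (integrableD measurableT (L2_integrable Lf) (L2_integrable Lg)).
  by apply: measurable_funB; exact: measurable_funM.
by move=> t; apply: le_trans (crossc_le _ _) (normcM_le _ _).
Qed.

Lemma L2B f g : L2 f -> L2 g -> L2 (fun x => f x - g x).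
Proof.
move=> Lf Lg; have [fr fi] := L2_measurable Lf; have [gr gi] := L2_measurable Lg.
have mfg : measurable_field (fun x => f x - g x).
  split; under eq_fun do rewrite raddfB; exact: measurable_funB.
case: (mfg) => mr mi; split => //; rewrite -/(L2norm2 _) L2norm2E//.
under eq_integral do rewrite normc_sub_sqr.
apply: integrable_lty => //.
have := integrableB measurableT
  (integrableD measurableT (L2_integrable Lf) (L2_integrable Lg))
  (@integrableZl _ _ _ _ _ measurableT 2 _ (integrable_dotc Lf Lg)).
by apply: eq_integrable => // t _ /=.
Qed.

Lemma rintE (u : 'cV[R]_n -> R) : m.-integrable setT (EFin \o (fun t => u (colv t))) ->
  rint u = \int[m]_t u (colv t).
Proof.
move=> iu; have mu : measurable_fun setT (fun t : n.-tuple R => u (colv t)).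
  by apply/measurable_EFinP; exact: measurable_int iu.
rewrite /rint /intv !mE; last 4 first.
- by apply/measurable_EFinP; apply: measurable_maxr => //; exact: measurableT_comp.
- by move=> t; rewrite lee_fin le_max lexx orbT.
- by apply/measurable_EFinP; exact: measurable_maxr.
- by move=> t; rewrite lee_fin le_max lexx orbT.
have fp := integrable_pos_fin_num measurableT iu.
have fn := integrable_neg_fin_num measurableT iu.
rewrite /Rintegral [in RHS]integralE [RHS]fineB//.
by congr (_ - _); congr fine; apply: eq_integral => t _;
  rewrite ?funeposE ?funenegE /= ?EFinN -EFin_max.
Qed.

(** The two factors are written as affine images of [t], the form to which [L2_affine] applies;
    integrability follows from the bound [|dotc| + |crossc|]. *)
Lemma Re_wigner f g x xi : L2 f -> L2 g ->
  let F t := f (2^-1 *: colv t + x) in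
  let G t := g (- 2^-1 *: colv t + x) in
  complex.Re (wigner f g x xi) =
  \int[m]_t (dotc (F t) (G t) * cos (2 * pi * dotv xi (colv t)) +
             crossc (F t) (G t) * sin (2 * pi * dotv xi (colv t))).
Proof.
move=> Lf Lg F G.
have h0 : 2^-1 != 0 :> R by rewrite invr_eq0 pnatr_eq0.
have h1 : - 2^-1 != 0 :> R by rewrite oppr_eq0.
have LF := L2_affine x h0 Lf; have LG := L2_affine x h1 Lg.
have iD := integrable_dotc LF LG; have iC := integrable_crossc LF LG.
have E t : complex.Re (f (x + 2^-1 *: colv t) * conjc (g (x - 2^-1 *: colv t)) *
    expi (- (2 * pi * dotv xi (colv t)))) =
    dotc (F t) (G t) * cos (2 * pi * dotv xi (colv t)) +
    crossc (F t) (G t) * sin (2 * pi * dotv xi (colv t)).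
  by rewrite Re_conj_expi /F /G scaleNr ![x + _]addrC.
rewrite /= rintE.
  by apply: eq_Rintegral => t _; rewrite E.
under eq_fun do rewrite E.
have := integrableD measurableT (integrable_norm iD) (integrable_norm iC).
apply: dominated_Rintegrable; last by move=> t; exact: trig_le2.
have md : measurable_fun setT (fun t : n.-tuple R => 2 * pi * dotv xi (colv t)).
  by apply: measurable_funM => //; exact: measurable_dotv.
apply: measurable_funD; apply: measurable_funM.
- by apply/measurable_EFinP; exact: measurable_int iD.
- exact: (measurableT_comp (@measurable_cos R)).
- by apply/measurable_EFinP; exact: measurable_int iC.
- exact: (measurableT_comp (@measurable_sin R)).
Qed.

Lemma L2norm2_eq0 f : L2 f -> L2norm2 f = 0%E ->
  {ae m, forall t, f (colv t) = 0}.
Proof.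
move=> Lf; have mf := L2_measurable Lf; rewrite L2norm2E// => f0.
have : (\int[m]_t `|(normc (f (colv t)) ^+ 2)%:E| = 0)%E.
  by under eq_integral do rewrite /= ger0_norm ?sqr_ge0//.
have mn : measurable_fun setT (fun t => (normc (f (colv t)) ^+ 2)%:E).
  by apply/measurable_EFinP; exact: measurable_normc_sqr.
move/(ae_eq_integral_abs _ measurableT mn).1.
by apply: filterS => t /(_ Logic.I) /= [] /normc_sqr_eq0.
Qed.

(** The preimage of a null set is null because [intn_affine] only rescales its measure. *)
Lemma ae_affine (a : R) b (P : 'cV[R]_n -> Prop) : a != 0 -> ae P ->
  {ae m, forall t, P (a *: colv t + b)}.
Proof.
move=> a0 [Z [mZ [Z0 PZ]]].
have mI (Z' : set (n.-tuple R)) : measurable Z' -> intn (fun t => (\1_Z' t)%:E) = m Z'.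
  move=> mZ'; rewrite mE//; last by apply/measurable_EFinP.
  by rewrite integral_indic// setIT.
have mpre : measurable (afft a (coords b) @^-1` Z).
  by rewrite -[X in measurable X]setTI; exact: measurable_afft.
exists (afft a (coords b) @^-1` Z); split => //.
- rewrite -mI// (_ : (fun _ => _) = (fun t => (\1_Z (afft a (coords b) t))%:E)).
    by rewrite (intn_affine (coords b) (g := fun t => (\1_Z t)%:E)) ?Z0 ?mule0//;
      apply/measurable_EFinP.
  by apply/funext => t; rewrite !indicE.
- by move=> t /= nP; apply: PZ; rewrite /= colv_afft.
Qed.

End square_integrable.

(** * The Fourier transform of [|f|^2] through the metaplectic operator *)

Section metaplectic_covariance.
Context {R : realType} {n : nat}.
Variables (A B C D : 'M[R]_n).
Variable Sh : ('cV[R]_n -> R[i]) -> ('cV[R]_n -> R[i]).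
Hypothesis sympS : symplectic (block_mx A B C D).
Hypothesis metaS : metaplectic (block_mx A B C D) Sh.
Variable m : {sigma_finite_measure set (n.-tuple R) -> \bar R}.
Hypothesis mE : forall g : n.-tuple R -> \bar R, measurable_fun setT g ->
  (forall t, 0 <= g t)%E -> intn g = (\int[m]_t g t)%E.
Local Notation normc := (@Normc.normc R).

Let half0 : 2^-1 != 0 :> R. Proof. by rewrite invr_eq0 pnatr_eq0. Qed.
Let nhalf0 : - 2^-1 != 0 :> R. Proof. by rewrite oppr_eq0. Qed.
Let N1 : -1 != 0 :> R. Proof. by rewrite oppr_eq0 oner_eq0. Qed.

(** Written as an affine substitution so that the lemmas on those apply. In the Wigner integral at
    position 0, pairing [f] with its reflection produces [|f (t / 2)|^2]. *)
Definition reflect (f : 'cV[R]_n -> R[i]) : 'cV[R]_n -> R[i] := fun x => f (-1 *: x + 0).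

Lemma L2_reflect f : L2 f -> L2 (reflect f). Proof. exact: L2_affine. Qed.

Lemma L2norm2_reflect f : L2 f -> L2norm2 (reflect f) = L2norm2 f.
Proof.
move=> Lf; rewrite /reflect L2norm2_affine//; last exact: L2_measurable.
by rewrite normrN1 expr1n invr1 mul1e.
Qed.

Lemma Rintegral_normc_sqr_affine (a : R) b f : a != 0 -> L2 f ->
  \int[m]_t (normc (f (a *: colv t + b)) ^+ 2) = `|a| ^- n * fine (L2norm2 f).
Proof.
move=> a0 Lf; rewrite /Rintegral -(L2norm2E mE (f := fun x => f (a *: x + b))).
  rewrite L2norm2_affine//; last exact: L2_measurable.
  rewrite fineM// (L2norm2E mE); last exact: L2_measurable.
  exact: integrable_fin_num (L2_integrable mE Lf).
by apply: measurable_field_affine; exact: L2_measurable.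
Qed.

(* At [z = 0] the Wigner function pairs [f] with a reflection, so the covariance
   there and the invariance of the norm give
   [|| Sh (reflect f) - reflect (Sh f) ||^2 = 0]. *)
Lemma metaplectic_reflect f : L2 f ->
  L2norm2 (fun x => Sh (reflect f) x - reflect (Sh f) x) = 0%E.
Proof.
move=> Lf; have [SL2 [_ [_ [Snorm [_ Swig]]]]] := metaS.
have Lg := L2_reflect Lf; have Lh := SL2 _ Lg; have Lk := SL2 _ Lf.
set h := Sh (reflect f); set k := Sh f.
have Lrk := L2_reflect Lk; have LG := L2B mE Lh Lrk.
have := congr1 (@complex.Re R) (Swig _ _ Lg Lf 0).
rewrite mulmx0 /wignerz !linear0 !(Re_wigner mE)//.
have dot0 t : 2 * pi * dotv 0 (colv t : 'cV[R]_n) = 0.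
  by rewrite -[0](scale0r 0) dotvZl mul0r mulr0.
under eq_Rintegral do rewrite dot0 cos0 sin0 mulr1 mulr0 addr0.
under [RHS]eq_Rintegral => t _.
  rewrite dot0 cos0 sin0 mulr1 mulr0 addr0 /reflect.
  rewrite !addr0 scalerA mulN1r dotcxx.
  over.
have := @Rintegral_normc_sqr_affine (- 2^-1) 0 f nhalf0 Lf.
under eq_Rintegral do rewrite addr0.
move=> -> W0.
pose G x := h x - reflect k x.
(* In the expanded square, both squared norms and the inner product equal the same multiple of the
   squared norm of [f], so they cancel as 1 + 1 - 2. *)
have : \int[m]_t (normc (G (2^-1 *: colv t + 0)) ^+ 2) = 0.
  have Lh2 := L2_affine 0 half0 Lh; have Lrk2 := L2_affine 0 half0 Lrk.
  have i1 := L2_integrable mE Lh2; have i2 := L2_integrable mE Lrk2.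
  have i3 := integrable_dotc mE Lh2 Lrk2.
  under eq_Rintegral do rewrite normc_sub_sqr.
  rewrite RintegralB//; last 2 first.
  - exact: (integrableD measurableT i1 i2).
  - exact: (@integrableZl _ _ _ _ _ measurableT 2 _ i3).
  rewrite RintegralD// RintegralZl// !Rintegral_normc_sqr_affine//.
  rewrite L2norm2_reflect// !Snorm// L2norm2_reflect//.
  have -> : \int[m]_t dotc (h (2^-1 *: colv t + 0)) (reflect k (2^-1 *: colv t + 0)) =
      `|- 2^-1| ^- n * fine (L2norm2 f).
    rewrite -W0; apply: eq_Rintegral => t _.
    by rewrite /reflect !addr0 scalerA mulN1r.
  by rewrite normrN; ring.
rewrite Rintegral_normc_sqr_affine// => /eqP.
rewrite mulf_eq0 gt_eqF ?invr_gt0 ?exprn_gt0 ?normr_gt0//= => /eqP G0.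
rewrite -[LHS]fineK ?G0// (L2norm2E mE); first exact: integrable_fin_num (L2_integrable mE LG).
exact: L2_measurable.
Qed.

Let kpair f u (t : n.-tuple R) := dotc (Sh f (2^-1 *: colv t + u)) (Sh f (2^-1 *: colv t - u)).
Let kcross f u (t : n.-tuple R) := crossc (Sh f (2^-1 *: colv t + u)) (Sh f (2^-1 *: colv t - u)).

(** Covariance of the Wigner distribution of [f] and [reflect f] at the point
    [S (0, v) = (B v, D v)]. On the other side [Sh (reflect f)] is replaced, almost everywhere, by
    [reflect (Sh f)], which turns the Wigner integral into an ambiguity function of [Sh f]. *)
Lemma ambiguity_covariance f v : L2 f ->
  \int[m]_t (normc (f (2^-1 *: colv t)) ^+ 2 * cos (2 * pi * dotv v (colv t))) =
  \int[m]_t (kpair f (B *m v) t * cos (2 * pi * dotv (D *m v) (colv t)) +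
             kcross f (B *m v) t * sin (2 * pi * dotv (D *m v) (colv t))).
Proof.
move=> Lf; have [SL2 [_ [_ [_ [_ Swig]]]]] := metaS.
have Lg := L2_reflect Lf; have Lh := SL2 _ Lg; have Lk := SL2 _ Lf.
have Lrk := L2_reflect Lk; have LG := L2B mE Lh Lrk.
have := congr1 (@complex.Re R) (Swig _ _ Lf Lg (block_mx A B C D *m col_mx 0 v)).
rewrite mulKmx ?symplectic_unit// symplectic_col /wignerz !(col_mxKu, col_mxKd).
rewrite !(Re_wigner mE)// => /esym W.
transitivity (\int[m]_t (dotc (f (2^-1 *: colv t + 0)) (reflect f (- 2^-1 *: colv t + 0)) *
     cos (2 * pi * dotv v (colv t)) +
   crossc (f (2^-1 *: colv t + 0)) (reflect f (- 2^-1 *: colv t + 0)) *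
     sin (2 * pi * dotv v (colv t)))).
  apply: eq_Rintegral => t _.
  by rewrite /reflect !addr0 scalerA mulrNN mul1r dotcxx crosscxx mul0r addr0.
rewrite W.
have LGu := L2_affine (B *m v) nhalf0 LG.
have G0 : L2norm2 (fun x => Sh (reflect f) (- 2^-1 *: x + B *m v) -
    reflect (Sh f) (- 2^-1 *: x + B *m v)) = 0%E.
  rewrite (L2norm2_affine (B *m v) nhalf0 (L2_measurable LG)).
  by rewrite metaplectic_reflect// mule0.
have aeG := L2norm2_eq0 mE LGu G0.
have mdot u : measurable_fun setT (fun t : n.-tuple R => 2 * pi * dotv u (colv t)).
  by apply: measurable_funM => //; exact: measurable_dotv.
have mtrig (P Q : n.-tuple R -> R) u : m.-integrable setT (EFin \o P) ->
    m.-integrable setT (EFin \o Q) -> measurable_fun setT (fun t =>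
    (P t * cos (2 * pi * dotv u (colv t)) + Q t * sin (2 * pi * dotv u (colv t)))%:E).
  move=> iP iQ; apply/measurable_EFinP; apply: measurable_funD; apply: measurable_funM.
  - by apply/measurable_EFinP; exact: measurable_int iP.
  - exact: (measurableT_comp (@measurable_cos R)).
  - by apply/measurable_EFinP; exact: measurable_int iQ.
  - exact: (measurableT_comp (@measurable_sin R)).
have Lk1 := L2_affine (B *m v) half0 Lk.
have Lk2 := L2_affine (- (B *m v)) half0 Lk.
have Lh2 := L2_affine (B *m v) nhalf0 Lh.
rewrite /Rintegral; congr fine; apply: ae_eq_integral => //.
- exact: (mtrig _ _ _ (integrable_dotc mE Lk1 Lh2) (integrable_crossc mE Lk1 Lh2)).
- exact: (mtrig (kpair f (B *m v)) (kcross f (B *m v)) _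
    (integrable_dotc mE Lk1 Lk2) (integrable_crossc mE Lk1 Lk2)).
move: aeG; apply: filterS => t /= /eqP; rewrite subr_eq0 => /eqP hk _.
rewrite hk /kpair /kcross /reflect addr0 scalerDr scalerA mulrNN mul1r scaleN1r.
by [].
Qed.

End metaplectic_covariance.

(** * The uncertainty principle *)

Section ae_domination.
Context {R : realType} {d : measure_display} {T : measurableType d}.
Variable m : {measure set T -> \bar R}.
Variables (f g : T -> R).
Hypotheses (mf : measurable_fun setT f) (ig : m.-integrable setT (EFin \o g)).
Hypothesis fg : {ae m, forall x, `|f x| <= g x}.

Let le_integral_ae : (\int[m]_x `|f x|%:E <= \int[m]_x `|g x|%:E)%E.
Proof.
have mg : measurable_fun setT g by apply/measurable_EFinP; exact: measurable_int ig.
apply: ae_ge0_le_integral => //.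
- by apply/measurable_EFinP; exact: measurableT_comp.
- by apply/measurable_EFinP; exact: measurableT_comp.
by apply: filterS fg => x fgx _; rewrite lee_fin (le_trans fgx)// ler_norm.
Qed.

Lemma ae_dominated_integrable : m.-integrable setT (EFin \o f).
Proof.
apply/integrableP; split; first by apply/measurable_EFinP.
by apply: le_lt_trans le_integral_ae _; have /integrableP[] := ig.
Qed.

Lemma ae_dominated_Rintegral : `|\int[m]_x f x| <= \int[m]_x `|g x|.
Proof.
have i_f := ae_dominated_integrable.
apply: le_trans (le_normr_Rintegral measurableT i_f) _.
rewrite /Rintegral fine_le//.
- exact: integrable_fin_num (integrable_norm i_f).
- exact: integrable_fin_num (integrable_norm ig).
Qed.

End ae_domination.

(** * Integrability of the weighted Gaussians *)

Section gaussian_weights.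
Context {R : realType} {n : nat}.
Variable m : {sigma_finite_measure set (n.-tuple R) -> \bar R}.
Hypothesis mE : forall g : n.-tuple R -> \bar R, measurable_fun setT g ->
  (forall t, 0 <= g t)%E -> intn g = (\int[m]_t g t)%E.

Lemma measurable_qf (Q : 'M[R]_n) :
  measurable_fun setT (fun t : n.-tuple R => qf Q (colv t)).
Proof.
under eq_fun do rewrite qfE; apply: measurable_sum => i.
apply: measurable_funM.
  rewrite (_ : (fun _ => _) = (fun t : n.-tuple R => tnth t i)); last first.
    by apply/funext => t; rewrite mxE.
  exact: measurable_tnth.
rewrite (_ : (fun _ => _) = (fun t : n.-tuple R => dotv (row i Q)^T (colv t))).
  exact: measurable_dotv.
by apply/funext => t; rewrite dotvE trmxK -row_mul [RHS]mxE.
Qed.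

(** The weight supplies decay in the directions that [Q] misses: by [psd_coercive] the total
    exponent dominates a multiple of [|x|^2]. The matrix [K] encodes the family [ps]. *)
Lemma integrable_weight (Q : 'M[R]_n) (ps : seq 'cV[R]_n) k (K : 'M[R]_(k, n)) (eps : R) :
  0 < eps -> sym_psd Q ->
  (forall x, \sum_(p <- ps) (dotv p x) ^+ 2 = dotv (K *m x) (K *m x)) ->
  (forall x : 'cV_n, Q *m x = 0 -> K *m x = 0 -> x = 0) ->
  m.-integrable setT
    (EFin \o (fun t => weight ps (colv t) * expR (- (eps * qf Q (colv t))))).
Proof.
move=> e0 Qpsd psK inj; have [c c0 coer] := psd_coercive Qpsd inj.
(* A common coefficient below both exponents: [eps] for the form and [(2 pi)^2 >= 1] for the
   weight. *)
pose e := Num.min eps 1; have e_gt0 : 0 < e by rewrite lt_min e0 ltr01.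
have eeps : e <= eps by rewrite ge_min lexx.
have e1 : e <= 1 by rewrite ge_min lexx orbT.
have mG : measurable_fun setT
    (fun t : n.-tuple R => expR (- (e * c * \sum_i (tnth t i) ^+ 2))).
  apply: measurableT_comp => //; apply: measurableT_comp => //.
  apply: measurable_funM => //; apply: measurable_sum => i.
  by apply: measurable_funX; exact: measurable_tnth.
have iG : m.-integrable setT
    (EFin \o (fun t : n.-tuple R => expR (- (e * c * \sum_i (tnth t i) ^+ 2)))).
  apply/integrableP; split; first by apply/measurable_EFinP.
  under eq_integral do rewrite /= ger0_norm ?expR_ge0//.
  rewrite -mE//; first by apply: intn_gaussian; rewrite mulr_gt0.
  by apply/measurable_EFinP.
apply: dominated_Rintegrable iG.
  apply: measurable_funM; first exact: measurable_weight.
  apply: measurableT_comp => //; apply: measurableT_comp => //.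
  by apply: measurable_funM => //; exact: measurable_qf.
move=> t; rewrite ger0_norm ?mulr_ge0 ?expR_ge0// -expRD ler_expR -opprD lerN2.
have -> : \sum_i tnth t i ^+ 2 = dotv (colv t) (colv t).
  by apply: eq_bigr => i _; rewrite !mxE expr2.
under eq_bigr do rewrite exprMn.
rewrite -mulr_sumr psK; set S := dotv (K *m _) _; set q := qf Q _.
have S0 : 0 <= S by exact: dotv_ge0.
have q0 : 0 <= q by exact: Qpsd.2.
apply: (@le_trans _ _ (e * (q + S))); first by rewrite -mulrA ler_wpM2l ?coer// ltW.
rewrite mulrDr addrC lerD// ler_wpM2r//.
apply: le_trans e1 _; rewrite -(expr1n _ 2) lerXn2r ?nnegrE ?mulr_ge0 ?pi_ge0//.
have := pi_ge2 R; lra.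
Qed.

End gaussian_weights.

Section kernel_rows.
Context {R : realType} {n : nat}.
Variable B : 'M[R]_n.

(** [kermx] is a left kernel, so the rows of [kermx B^T], transposed, span [ker B]. *)
Definition ker_rows : 'M[R]_n := kermx B^T.
Definition ker_seq : seq 'cV[R]_n := [seq (row i ker_rows)^T | i <- index_enum 'I_n].

Lemma ker_seq_mul : {in ker_seq, forall p, B *m p = 0}.
Proof.
move=> _ /mapP[i _ ->]; apply: trmx_inj.
by rewrite trmx_mul trmxK -row_mul mulmx_ker trmx0 row0.
Qed.

Lemma sum_ker_seq (D : 'M[R]_n) x :
  \sum_(p <- [seq D *m q | q <- ker_seq]) (dotv p x) ^+ 2 =
  dotv (ker_rows *m D^T *m x) (ker_rows *m D^T *m x).
Proof.
rewrite !big_map; apply: eq_bigr => i _.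
rewrite dotvC dotv_mulmx dotvC dotvE trmxK -row_mul mxE mulmxA.
by rewrite expr2.
Qed.

Lemma ker_rows_dotv (x p : 'cV[R]_n) : ker_rows *m x = 0 -> B *m p = 0 -> dotv p x = 0.
Proof.
move=> Kx Bp; have : (p^T <= ker_rows)%MS by apply/sub_kermxP; rewrite -trmx_mul Bp trmx0.
by move=> /submxP[u pu]; rewrite dotvE pu -mulmxA Kx mulmx0 mxE.
Qed.

End kernel_rows.

Theorem theorem1p5 (R : realType) (d : nat) (A B C D : 'M[R]_d)
    (Sh : ('cV[R]_d -> R[i]) -> ('cV[R]_d -> R[i]))
    (M N : 'M[R]_d) (f : 'cV[R]_d -> R[i]) (c : R) :
  symplectic (block_mx A B C D) ->
  B != 0 ->
  metaplectic (block_mx A B C D) Sh ->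
  sym_psd M -> sym_psd N ->
  mxker M = mxker B ->
  mxrange N = mxrange B ->
  L2 f ->
  0 < c ->
  ae (fun x => Normc.normc (f x) <= c * expR (- (pi * qf M x))) ->
  ae (fun xi => Normc.normc (Sh f xi) <= c * expR (- (pi * qf N xi))) ->
  (exists lambda : R, 1 < lambda /\ eigenvalue (M *m B^T *m N *m B) lambda) ->
  ae (fun x => f x = 0).
Proof.
move=> sympS _ metaS Mpsd Npsd kerMB ranNB Lf c0 decf decSf [lambda [l1 eig]].
have [m mE] := @intn_integral R d.
have [SL2 _] := metaS; have Lk := SL2 _ Lf.
have MB (x : 'cV_d) : M *m x = 0 -> B *m x = 0.
  by move=> Mx; have : mxker B x by rewrite -kerMB.
(* [ker N] is the orthogonal complement of the range of [N], which is that of [B]; so it lies in the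
   kernel of [B^T]. *)
have NB (x : 'cV_d) : N *m x = 0 -> B^T *m x = 0.
  move=> Nx; apply/colP => i; rewrite [RHS]mxE.
  have [z Bz] : mxrange N (B *m delta_mx i 0) by rewrite ranNB; exists (delta_mx i 0).
  have -> : (B^T *m x) i 0 = dotv (B *m delta_mx i 0) x.
    by rewrite dotvC dotv_mulmx dotvC dotvE trmx_delta -rowE [RHS]mxE.
  by rewrite Bz dotvC dotv_mulmx Npsd.1 Nx /dotv big1// => j _; rewrite mxE mul0r.
clear kerMB ranNB.
have l0 : 0 < lambda by lra.
have [b alpha0 betaE] := eigenvalue_direction Mpsd Npsd l0 eig.
set alpha := qf M b in alpha0 betaE; pose a := M *m b.
have pi0 := @pi_gt0 R.
(* The midpoint of [1 / lambda] and 1: a fraction [theta] of the decay of [f] pays for the Hardy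
   weight and [1 - theta] is kept for integrability. *)
pose theta := (lambda + 1) / (2 * lambda).
have theta1 : theta < 1 by rewrite ltr_pdivrMr; lra.
have theta0 : 0 < theta by rewrite divr_gt0; lra.
have ltheta : 1 < lambda * theta.
  have -> : lambda * theta = (lambda + 1) / 2 by rewrite /theta; field; lra.
  lra.
(* [sigma] makes [sigma y^2 <= theta (pi / 2) qf M], and [gamma tau^2] is [2 pi qf N (tau B a)].
   Their product gives [4 gamma sigma = lambda theta]. *)
pose sigma := theta / (8 * pi * alpha).
pose gamma := 2 * pi * lambda * alpha.
have sigma0 : 0 < sigma by rewrite divr_gt0// !mulr_gt0.
have slack : 1 < 4 * gamma * sigma.
  have -> // : 4 * gamma * sigma = lambda * theta.
  have E (p q : R) : p != 0 -> q != 0 ->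
      4 * (2 * p * lambda * q) * (theta / (8 * p * q)) = lambda * theta.
    by move=> p0 q0; field; rewrite p0 q0.
  by apply: E; rewrite gt_eqF.
have half0 : 2^-1 != 0 :> R by rewrite invr_eq0 pnatr_eq0.
have Lf2 := L2_affine 0 half0 Lf.
pose phi (t : d.-tuple R) := Normc.normc (f (2^-1 *: colv t + 0)) ^+ 2.
have iphi : m.-integrable setT (EFin \o phi) := L2_integrable mE Lf2.
have mphi : measurable_fun setT phi by apply/measurable_EFinP; exact: measurable_int iphi.
have phi0 t : 0 <= phi t by exact: sqr_ge0.
pose X u (t : d.-tuple R) := dotc (Sh f (2^-1 *: colv t + u)) (Sh f (2^-1 *: colv t - u)).
pose Y u (t : d.-tuple R) := crossc (Sh f (2^-1 *: colv t + u)) (Sh f (2^-1 *: colv t - u)).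
have iX u : m.-integrable setT (EFin \o X u) :=
  integrable_dotc mE (L2_affine u half0 Lk) (L2_affine (- u) half0 Lk).
have iY u : m.-integrable setT (EFin \o Y u) :=
  integrable_crossc mE (L2_affine u half0 Lk) (L2_affine (- u) half0 Lk).
have cov v : \int[m]_t (phi t * cos (2 * pi * dotv v (colv t))) =
  \int[m]_t (X (B *m v) t * cos (2 * pi * dotv (D *m v) (colv t)) +
             Y (B *m v) t * sin (2 * pi * dotv (D *m v) (colv t))).
  rewrite -(ambiguity_covariance sympS metaS mE v Lf).
  by apply: eq_Rintegral => t _; rewrite /phi addr0.
pose ps := ker_seq B; pose qs := [seq D *m p | p <- ps].
pose w t := weight ps (colv t) * phi t.
pose y (t : d.-tuple R) := 2 * pi * dotv a (colv t).
have mw : measurable_fun setT w by apply: measurable_funM => //; exact: measurable_weight.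
have my : measurable_fun setT y by apply: measurable_funM => //; exact: measurable_dotv.
have w0 t : 0 <= w t by rewrite mulr_ge0// expR_ge0.
(* Squaring doubles the exponent and halving the argument divides it by 4, whence [pi / 2]. *)
have phi_le : {ae m, forall t, phi t <= c ^+ 2 * expR (- (pi / 2 * qf M (colv t)))}.
  have := ae_affine mE 0 half0 decf; apply: filterS => t fb.
  apply: (@le_trans _ _ ((c * expR (- (pi * qf M (2^-1 *: colv t + 0)))) ^+ 2)).
    by rewrite lerXn2r ?nnegrE ?mulr_ge0 ?expR_ge0 ?normc_nneg ?(ltW c0).
  rewrite exprMn -expRM_natl addr0 qfE -scalemxAr dotvZl dotvZr -qfE.
  have E (p q : R) : 2%:R * - (p * (2^-1 * (2^-1 * q))) = - (p / 2 * q) by field.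
  by rewrite E.
have iw : m.-integrable setT (EFin \o (fun t => w t * expR (sigma * y t ^+ 2))).
  pose eps := pi / 2 * (1 - theta).
  have eps0 : 0 < eps by rewrite mulr_gt0 ?divr_gt0// subr_gt0.
  (* Such an [x] lies in [ker B] and is orthogonal to [ker B]. *)
  have inj (x : 'cV_d) : M *m x = 0 -> ker_rows B *m x = 0 -> x = 0.
    by move=> /MB Bx Kx; apply: dotv_eq0; exact: ker_rows_dotv Kx Bx.
  have psK x : \sum_(p <- ps) dotv p x ^+ 2 = dotv (ker_rows B *m x) (ker_rows B *m x).
    have := sum_ker_seq B 1%:M x; rewrite trmx1 mulmx1 big_map => <-.
    by apply: eq_bigr => p _; rewrite mul1mx.
  have iG := @integrableZl _ _ _ _ _ measurableT (c ^+ 2) _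
    (integrable_weight mE eps0 Mpsd psK inj).
  apply: (@ae_dominated_integrable _ _ _ m _ (fun t => c ^+ 2 *
    (weight ps (colv t) * expR (- (eps * qf M (colv t))))) _ iG).
    apply: measurable_funM => //; apply: measurableT_comp => //.
    by apply: measurable_funM => //; exact: measurable_funX.
  move: phi_le; apply: filterS => t pt.
  rewrite ger0_norm; last by rewrite mulr_ge0 ?expR_ge0.
  rewrite [leLHS](_ : _ = weight ps (colv t) * (phi t * expR (sigma * y t ^+ 2))); last first.
    exact/esym/mulrA.
  rewrite [leRHS]mulrCA ler_wpM2l ?expR_ge0//.
  apply: (@le_trans _ _ (c ^+ 2 * expR (- (pi / 2 * qf M (colv t))) * expR (sigma * y t ^+ 2))).
    by rewrite ler_wpM2r ?expR_ge0.
  rewrite -mulrA ler_wpM2l ?sqr_ge0// -expRD ler_expR.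
  (* As [a = M b], this is Cauchy-Schwarz for the form [M] between [b] and the point. *)
  have CS : dotv a (colv t) ^+ 2 <= alpha * qf M (colv t).
    rewrite /a dotvC dotv_mulmx Mpsd.1 dotvC.
    exact: qf_cauchy_schwarz.
  rewrite /y /eps exprMn.
  have -> : sigma * ((2 * pi) ^+ 2 * dotv a (colv t) ^+ 2) =
      (pi / 2 * theta) * (dotv a (colv t) ^+ 2 / alpha).
    have E (p q x : R) : p != 0 -> q != 0 ->
        theta / (8 * p * q) * ((2 * p) ^+ 2 * x) = p / 2 * theta * (x / q).
      by move=> p0 q0; field; rewrite p0 q0.
    by apply: E; rewrite gt_eqF.
  have : dotv a (colv t) ^+ 2 / alpha <= qf M (colv t) by rewrite ler_pdivrMr// mulrC.
  have : 0 < pi / 2 * theta by rewrite mulr_gt0// divr_gt0.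
  by move=> h1 /(ler_wpM2l (ltW h1)); lra.
pose I := \int[m]_t `|2 * c ^+ 2 * (weight qs (colv t) * expR (- (pi / 2 * qf N (colv t))))|.
have decF tau : `|\int[m]_t (w t * cos (tau * y t))| <= I * expR (- (gamma * tau ^+ 2)).
  pose v := tau *: a; pose u := B *m v.
  have -> : \int[m]_t (w t * cos (tau * y t)) =
      \int[m]_t (weight ps (colv t) * phi t * cos (2 * pi * dotv v (colv t))).
    by apply: eq_Rintegral => t _; rewrite /v dotvZl /y /w; congr (_ * cos _); ring.
  rewrite (weighted_covariance iphi iX iY cov); last exact: ker_seq_mul.
  have iG : m.-integrable setT (EFin \o (fun t =>
      weight qs (colv t) * expR (- (pi / 2 * qf N (colv t))))).
    apply: (@integrable_weight _ _ m mE N qs d (ker_rows B *m D^T)) => //.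
    - by rewrite divr_gt0.
    - exact: sum_ker_seq.
    (* The images under [D] of vectors of [ker B] control the directions in which [N] gives no
       decay. *)
    - move=> x /NB Bx Kx; apply: (symplectic_ker_inj sympS Bx) => p Bp.
      by apply: ker_rows_dotv Bp; rewrite mulmxA.
  pose e := expR (- (gamma * tau ^+ 2)).
  have iG2 := @integrableZl _ _ _ _ _ measurableT (e * (2 * c ^+ 2)) _ iG.
  apply: le_trans (@ae_dominated_Rintegral _ _ _ m _ (fun t => e * (2 * c ^+ 2) *
    (weight qs (colv t) * expR (- (pi / 2 * qf N (colv t))))) _ iG2 _) _.
  - apply: measurable_funM; first exact: measurable_weight.
    have mdot : measurable_fun setT
        (fun t : d.-tuple R => 2 * pi * dotv (D *m v) (colv t)).
      by apply: measurable_funM => //; exact: measurable_dotv.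
    apply: measurable_funD; apply: measurable_funM.
    + by apply/measurable_EFinP; exact: measurable_int (iX u).
    + exact: (measurableT_comp (@measurable_cos R)).
    + by apply/measurable_EFinP; exact: measurable_int (iY u).
    + exact: (measurableT_comp (@measurable_sin R)).
  - move: (ae_affine mE u half0 decSf) (ae_affine mE (- u) half0 decSf).
    apply: filterS2 => t k1 k2.
    rewrite normrM (ger0_norm (expR_ge0 _ : 0 <= weight _ _)) mulrCA ler_wpM2l ?expR_ge0//.
    apply: le_trans (trig_le2 _ _ _) _.
    (* The parallelogram identity: the values of [qf N] at [t / 2 + u] and [t / 2 - u] add up to
       [qf N t / 2 + 2 qf N u]. The second term, with [qf N u = tau^2 lambda alpha], is the decay in
       [tau]. *)
    have kk : Normc.normc (Sh f (2^-1 *: colv t + u)) * Normc.normc (Sh f (2^-1 *: colv t - u)) <=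
        c ^+ 2 * (e * expR (- (pi / 2 * qf N (colv t)))).
      apply: le_trans (ler_pM (normc_nneg _) (normc_nneg _) k1 k2) _.
      rewrite mulrACA -expr2 -!expRD ler_wpM2l ?sqr_ge0// ler_expR.
      rewrite -{1}(scale1r u) -(scaleN1r u).
      have -> := qf_lincomb Npsd 2^-1 1 (colv t) u.
      have -> := qf_lincomb Npsd 2^-1 (- 1) (colv t) u.
      have -> : qf N u = tau ^+ 2 * (lambda * alpha).
        by rewrite /u /v -scalemxAr qfE -scalemxAr dotvZl dotvZr -qfE betaE mulrA.
      by rewrite /gamma; lra.
    apply: le_trans (lerD (dotc_le _ _) (crossc_le _ _)) _.
    apply: le_trans (lerD kk kk) _.
    by rewrite le_eqVlt; apply/orP; left; apply/eqP; ring.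
  have iG3 := @integrableZl _ _ _ _ _ measurableT (2 * c ^+ 2) _ iG.
  rewrite [leRHS]mulrC -/e /I -RintegralZl//; last exact: integrable_norm iG3.
  rewrite le_eqVlt; apply/orP; left; apply/eqP; apply: eq_Rintegral => t _.
  by rewrite -[X in `|X|]mulrA normrM (ger0_norm (expR_ge0 _ : 0 <= e)).
have := hardy_measure mw my w0 iw sigma0 slack decF.
move=> wae.
(* The weight is everywhere positive, so [w = 0] forces [phi = 0]. *)
have {wae} L0 : L2norm2 (fun x => f (2^-1 *: x + 0)) = 0%E.
  rewrite (L2norm2E mE); last exact: L2_measurable.
  transitivity (\int[m]_t (cst 0 t : \bar R))%E; last by rewrite integral_cst// mul0e.
  apply: ae_eq_integral => //; first by apply/measurable_EFinP.
  move: wae; apply: filterS => t /(_ Logic.I) /= [] /eqP.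
  by rewrite mulf_eq0 /weight expR_eq0/= => /eqP pt _; rewrite -[X in X%:E]/(phi t) pt.
have {}L0 : L2norm2 f = 0%E.
  move/eqP: L0; rewrite L2norm2_affine//; last exact: L2_measurable.
  rewrite mule_eq0 eqe invr_eq0 expf_eq0 normr_eq0 (negbTE half0) andbF/=.
  by move/eqP.
have [Z [mZ Z0 fZ]] := L2norm2_eq0 mE Lf L0.
exists Z; split=> //; split=> //.
rewrite mE//; last by apply/measurable_EFinP.
by rewrite integral_indic// setIT.
Qed.
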